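(* Let $\Bbbk$ be a field, $S=\Bbbk[x_1,\ldots,x_n]$, and let $\mathfrak{a}=\mathfrak{f}+(G)\subseteq S$ be an Artinian almost complete intersection of degrees $(\mathbf{d};D)=(d_1,\ldots,d_n;D)$ with $D\le\sigma=\sum_{i=1}^n(d_i-1)$. Then $\operatorname{HF}(S/\mathfrak{a};m)\le\operatorname{HF}(S/(x_1^{d_1},\ldots,x_n^{d_n});m)-\varphi_m$ for all $D<m\le\sigma$. In particular, $\operatorname{e}(S/\mathfrak{a})\le\prod_{i=1}^n d_i-\sum_{m=D+1}^{\sigma}\varphi_m-1$.
   Context: $S$ is standard graded; $\operatorname{HF}(M;j)=\dim_\Bbbk M_j$; $\operatorname{e}$ is multiplicity. An almost complete intersection of degrees $(\mathbf{d};D)=(d_1,\ldots,d_h;D)$ is a homogeneous ideal $\mathfrak{a}$ of height $h$ with $\mathfrak{a}=\mathfrak{f}+(G)$, $\mathfrak{f}$ generated by a homogeneous regular sequence of degrees $d_1\le\cdots\le d_h$, $G$ homogeneous of degree $D$, $G\notin\mathfrak{f}$. For $\mathbf{d}=(d_1,\ldots,d_h)$ and $E\le\sum(d_i-1)$, in $\overline{S}=\Bbbk[x_1,\ldots,x_h]$ let $U_E$ be the lex-largest monomial ($x_1>\cdots>x_h$) of degree $E$ not in $(\mathsf{x}^{\mathbf{d}})=(x_1^{d_1},\ldots,x_h^{d_h})$ and $\mathcal{L}(\mathbf{d};E)=(\mathsf{x}^{\mathbf{d}})+(U_E)$. With $\sigma=\sum_{i=1}^h(d_i-1)$, define $\varphi_m=\operatorname{HF}(\overline{S}/(\mathsf{x}^{\mathbf{d}});m)-\operatorname{HF}(\overline{S}/\mathcal{L}(\mathbf{d};m-1);m)$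 if $2\le m\le\sigma$, and $\varphi_m=0$ otherwise. Sums $\sum_{m=i}^j$ with $j<i$ are $0$. *)

(* Defs.v *)
From mathcomp Require Import all_boot all_order all_algebra.
From mathcomp Require Import mpoly.
From Stdlib Require Import ClassicalEpsilon.

Set Implicit Arguments.
Unset Strict Implicit.
Unset Printing Implicit Defensive.

Import GRing.Theory.
Local Open Scope ring_scope.

Definition decP (P : Prop) : bool :=
  if excluded_middle_informative P then true else false.

(* Supremum of a set of naturals P (0 if P is unbounded or empty). *)
Definition natsup (P : nat -> Prop) : nat :=
  match excluded_middle_informative (exists N, forall r, P r -> (r <= N)%N) with
  | left H =>
      let N := proj1_sig (constructive_indefinite_description _ H) in
      (\max_(r < N.+1 | decP (P r)) r)%N
  | right _ => 0%N
  end.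

Section Ideals.
Variables (k : fieldType) (n : nat).
Local Notation S := {mpoly k[n]}.

Definition in_ideal (gs : seq S) (p : S) : Prop :=
  exists c : seq S, size c = size gs /\
    p = \sum_(i < size gs) c`_i * gs`_i.

Definition lin_indep_mod (gs : seq S) (ps : seq S) : Prop :=
  forall c : seq k, size c = size ps ->
    in_ideal gs (\sum_(i < size ps) c`_i *: ps`_i) ->
    forall i, (i < size ps)%N -> c`_i = 0.

(* Hilbert function HF(S/(gs); m) = dim_k (S/(gs))_m, for gs homogeneous:
   maximal number of degree-m forms linearly independent modulo (gs). *)
Definition HF (gs : seq S) (m : nat) : nat :=
  natsup (fun r => exists ps : seq S,
    [/\ size ps = r, all (fun p => p \is m.-homog) ps & lin_indep_mod gs ps]).

Definition qdim_bounded (gs : seq S) : Prop :=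
  exists N, forall ps : seq S, lin_indep_mod gs ps -> (size ps <= N)%N.

(* S/(gs) is Artinian (for a finitely generated k-algebra: of finite length) *)
Definition artinian (gs : seq S) : Prop := qdim_bounded gs.

(* multiplicity of an Artinian S/(gs) = its length = dim_k S/(gs) *)
Definition mult_artinian (gs : seq S) : nat :=
  natsup (fun r => exists ps : seq S, size ps = r /\ lin_indep_mod gs ps).

Definition regular_seq (fs : seq S) : Prop :=
  ~ in_ideal fs 1 /\
  forall i, (i < size fs)%N -> forall g : S,
    in_ideal (take i fs) (g * fs`_i) -> in_ideal (take i fs) g.

Definition lex_gt (a b : 'X_{1..n}) : bool :=
  [exists i : 'I_n, [forall j : 'I_n, (j < i)%N ==> (a j == b j)] && (b i < a i)%N].

Definition pure_powers (d : 'I_n -> nat) : seq S :=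
  [seq 'X_i ^+ d i | i <- enum 'I_n].

Definition U_spec (d : 'I_n -> nat) (E : nat) (u : 'X_{1..n}) : Prop :=
  [/\ mdeg u = E, ~ in_ideal (pure_powers d) 'X_[u] &
      forall v : 'X_{1..n}, mdeg v = E -> ~ in_ideal (pure_powers d) 'X_[v] ->
        v = u \/ lex_gt u v].

Definition U_mon (d : 'I_n -> nat) (E : nat) : 'X_{1..n} :=
  epsilon (inhabits 0%MM) (U_spec d E).

Definition Llex (d : 'I_n -> nat) (E : nat) : seq S :=
  rcons (pure_powers d) 'X_[U_mon d E].

Definition sigma (d : 'I_n -> nat) : nat := (\sum_(i < n) (d i - 1))%N.

Definition phi (d : 'I_n -> nat) (m : nat) : int :=
  if (2 <= m <= sigma d)%N
  then (HF (pure_powers d) m)%:Z - (HF (Llex d m.-1) m)%:Z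
  else 0.

End Ideals.

(* Main.v *)
Require Import Defs.
From mathcomp Require Import all_boot all_order all_algebra.
From mathcomp Require Import mpoly zify.
From Stdlib Require ClassicalEpsilon.

Set Implicit Arguments.
Unset Strict Implicit.
Unset Printing Implicit Defensive.

Import Order.TTheory GRing.Theory Num.Theory.
Local Open Scope ring_scope.

(* Put f = (f_1..f_n) and let H be a form of degree E not in (f) killed modulo
   (f) by r independent linear forms l. Then H is a nonzero class in the top
   Koszul cohomology of l with values in S/(f), which is Tor_r(S/(l), S/(f)).
   Computed from the Koszul complex of f instead, this Tor lives in degrees at
   least d_1 + .. + d_r, so E >= (d_1 - 1) + .. + (d_r - 1). For the lex-largest
   monomial U of degree E < sigma this bound forces r to be at most the number
   of variables annihilating U modulo the pure powers; so the space of linear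
   multiples of H modulo (f) is at least as large as that of U modulo the pure
   powers, while S/(f) and S/(x_1^d_1..x_n^d_n) have the same Hilbert function.
   The case r = n also shows that the socle of S/(f) lives in degree sigma, so
   that G has, in every degree E with D <= E <= sigma, a multiple H outside (f). *)

(** * Ideal membership and grading *)

Section IdealMembership.
Variables (k : fieldType) (n : nat).
Local Notation S := {mpoly k[n]}.
Implicit Types (gs : seq S) (p q g : S).

Lemma in_ideal_nil p : in_ideal [::] p <-> p = 0.
Proof.
split=> [[c [_ ->]]|->]; first by rewrite big_ord0.
by exists [::]; rewrite big_ord0.
Qed.

(** Peeling off the last generator turns membership into a recursion; the inductions below run from
    the right end of the list, where regular sequences grow. *)
Lemma in_ideal_rcons gs g p :
  in_ideal (rcons gs g) p <-> exists a, in_ideal gs (p - a * g).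
Proof.
split=> [[c [sc ->]]|[a [c [sc e]]]].
  move: c sc; case/lastP => [|c a]; rewrite !size_rcons // => -[sc].
  exists a, c; split=> //; rewrite big_ord_recr /=.
  rewrite !nth_rcons sc ltnn eqxx addrK.
  by apply: eq_bigr => i _; rewrite !nth_rcons sc ltn_ord.
exists (rcons c a); split; first by rewrite !size_rcons sc.
rewrite size_rcons big_ord_recr /= !nth_rcons sc ltnn eqxx.
rewrite -[LHS](subrK (a * g)) e; congr (_ + _).
by apply: eq_bigr => i _; rewrite !nth_rcons sc ltn_ord.
Qed.

Lemma in_ideal0 gs : in_ideal gs 0.
Proof.
exists (nseq (size gs) 0); split; first by rewrite size_nseq.
by rewrite big1 // => i _; rewrite nth_nseq ltn_ord mul0r.
Qed.

Lemma in_idealD gs p q : in_ideal gs p -> in_ideal gs q -> in_ideal gs (p + q).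
Proof.
elim/last_ind: gs p q => [|gs g IH] p q.
  by rewrite !in_ideal_nil => -> ->; rewrite addr0.
rewrite !in_ideal_rcons => -[a pa] [b qb]; exists (a + b).
by rewrite mulrDl opprD addrACA; apply: IH.
Qed.

Lemma in_idealM gs p q : in_ideal gs p -> in_ideal gs (q * p).
Proof.
elim/last_ind: gs p => [|gs g IH] p.
  by rewrite !in_ideal_nil => ->; rewrite mulr0.
rewrite !in_ideal_rcons => -[a pa]; exists (q * a).
by rewrite -mulrA -mulrBr; apply: IH.
Qed.

Lemma in_idealN gs p : in_ideal gs p -> in_ideal gs (- p).
Proof. by rewrite -mulN1r; apply: in_idealM. Qed.

Lemma in_idealB gs p q : in_ideal gs p -> in_ideal gs q -> in_ideal gs (p - q).
Proof. by move=> Ip Iq; apply: in_idealD => //; apply: in_idealN. Qed.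

Lemma in_idealZ gs (c : k) p : in_ideal gs p -> in_ideal gs (c *: p).
Proof. by rewrite -mul_mpolyC; apply: in_idealM. Qed.

Lemma in_ideal_sum gs (I : Type) (r : seq I) (P : pred I) (F : I -> S) :
  (forall i, P i -> in_ideal gs (F i)) -> in_ideal gs (\sum_(i <- r | P i) F i).
Proof. by move=> IF; apply: big_ind => //; [exact: in_ideal0 | exact: in_idealD]. Qed.

Lemma in_ideal_rconsl gs g p : in_ideal gs p -> in_ideal (rcons gs g) p.
Proof. by move=> Ip; apply/in_ideal_rcons; exists 0; rewrite mul0r subr0. Qed.

Lemma in_ideal_rconsr gs g : in_ideal (rcons gs g) g.
Proof. by apply/in_ideal_rcons; exists 1; rewrite mul1r subrr; apply: in_ideal0. Qed.

Lemma in_ideal_mem gs g : g \in gs -> in_ideal gs g.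
Proof.
elim/last_ind: gs => [//|gs h IH]; rewrite mem_rcons inE => /predU1P [->|/IH].
  exact: in_ideal_rconsr.
exact: in_ideal_rconsl.
Qed.

Lemma in_ideal_subset gs gs' p :
  (forall g, g \in gs -> in_ideal gs' g) -> in_ideal gs p -> in_ideal gs' p.
Proof.
elim/last_ind: gs p => [|gs g IH] p sub.
  by rewrite in_ideal_nil => ->; apply: in_ideal0.
rewrite in_ideal_rcons => -[a pa]; rewrite -[p](subrK (a * g)).
apply: in_idealD; first by apply: IH pa => h hgs; apply: sub; rewrite mem_rcons inE hgs orbT.
by apply/in_idealM/sub; rewrite mem_rcons mem_head.
Qed.

End IdealMembership.

(** * Homogeneous components and graded ideals *)

Section Grading.
Variables (k : fieldType) (n : nat).
Local Notation S := {mpoly k[n]}.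
Implicit Types (gs : seq S) (p q g : S).

(* Integer degrees: a form of negative degree is zero. *)
Definition zhomog (e : int) p := forall m, p@_m != 0 -> (mdeg m)%:Z = e.

Definition zcomp (e : int) p : S := if e is Posz m then pihomog mdeg m p else 0.

Lemma zhomogP (d : nat) p : zhomog d p <-> p \is d.-homog.
Proof.
split=> [hp|/dhomogP hp m]; last by rewrite -mcoeff_msupp => /hp ->.
by apply/dhomogP => m; rewrite mcoeff_msupp => /hp [].
Qed.

Lemma dhomog_zhomog (d : nat) p : p \is d.-homog -> zhomog d p.
Proof. by move/zhomogP. Qed.

Lemma zhomog_lt0 e p : e < 0 -> zhomog e p -> p = 0.
Proof.
move=> e0 hp; apply/mpolyP => m; rewrite mcoeff0; apply/eqP/negPn/negP => /hp em.
by move: e0; rewrite -em.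
Qed.

Lemma zhomog0 e : zhomog e 0.
Proof. by move=> m; rewrite mcoeff0 eqxx. Qed.

Lemma zhomogD e p q : zhomog e p -> zhomog e q -> zhomog e (p + q).
Proof.
move=> hp hq m; rewrite mcoeffD; have [->|/hp //] := eqVneq p@_m 0.
by rewrite add0r => /hq.
Qed.

Lemma zhomogN e p : zhomog e p -> zhomog e (- p).
Proof. by move=> hp m; rewrite mcoeffN oppr_eq0 => /hp. Qed.

Lemma zhomogM e e' p q : zhomog e p -> zhomog e' q -> zhomog (e + e') (p * q).
Proof.
move=> hp hq m; rewrite -mcoeff_msupp => /msuppM_le /allpairsP [[a b] /= [ha hb ->]].
by rewrite mdegD PoszD (hp a) -?mcoeff_msupp // (hq b) -?mcoeff_msupp.
Qed.

Lemma zcompD e p q : zcomp e (p + q) = zcomp e p + zcomp e q.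
Proof. by case: e => d /=; rewrite ?addr0 ?pihomogD. Qed.

Lemma zcompN e p : zcomp e (- p) = - zcomp e p.
Proof. by case: e => d /=; rewrite ?oppr0 ?pihomogN. Qed.

Lemma zcompB e p q : zcomp e (p - q) = zcomp e p - zcomp e q.
Proof. by rewrite zcompD zcompN. Qed.

Lemma zcompZ e c p : zcomp e (c *: p) = c *: zcomp e p.
Proof. by case: e => d /=; rewrite ?scaler0 ?linearZ. Qed.

Lemma zcomp0 e : zcomp e 0 = 0.
Proof. by case: e => d //=; rewrite pihomog0. Qed.

Lemma zcomp_sum e (I : Type) (r : seq I) (P : pred I) (F : I -> S) :
  zcomp e (\sum_(i <- r | P i) F i) = \sum_(i <- r | P i) zcomp e (F i).
Proof. by apply: (big_morph (zcomp e)) => [p q|]; rewrite ?zcompD ?zcomp0. Qed.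

Lemma zcomp_homog e p : zhomog e (zcomp e p).
Proof. by case: e => d /=; [apply/zhomogP/pihomogP | apply: zhomog0]. Qed.

Lemma zcomp_id e p : zhomog e p -> zcomp e p = p.
Proof.
case: e => d /=; first by move/zhomogP/pihomog_dE.
by move/zhomog_lt0 => -> //.
Qed.

Lemma zcomp_neq e e' p : e != e' -> zhomog e p -> zcomp e' p = 0.
Proof.
case: e' => d' //=; case: e => d; last by move=> _ /zhomog_lt0 ->; rewrite ?pihomog0.
by move=> ne /zhomogP; apply: pihomog_ne0.
Qed.

Lemma zhomogX m : zhomog (mdeg m) 'X_[m].
Proof. by apply/zhomogP; rewrite dhomogX. Qed.

(** By linearity [p] may be taken to be a monomial, and then both sides vanish unless its degree is
    [e - d]. Integer degrees make this uniform even when [e - d] is negative. *)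
Lemma zcompM e d p g : zhomog d g -> zcomp e (p * g) = zcomp (e - d) p * g.
Proof.
move=> hg; rewrite [p]mpolyE mulr_suml !zcomp_sum mulr_suml.
apply: eq_bigr => m _; rewrite -scalerAl !zcompZ -scalerAl; congr (_ *: _).
have hm := zhomogM (@zhomogX m) hg.
have [em|nm] := eqVneq ((mdeg m)%:Z) (e - d).
  rewrite -em [zcomp _ 'X_[m]]zcomp_id; last exact: zhomogX.
  by rewrite zcomp_id // -[e](subrK d) -em.
rewrite (zcomp_neq nm (@zhomogX m)) mul0r (zcomp_neq _ hm) //.
by apply: contraNneq nm => <-; rewrite addrK.
Qed.

Definition graded gs := forall g, g \in gs -> exists d : nat, g \is d.-homog.

Lemma graded_rcons gs g : graded (rcons gs g) ->
  graded gs /\ exists d : nat, g \is d.-homog.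
Proof.
move=> h; split=> [x xgs|]; apply: h; rewrite mem_rcons ?mem_head //.
by rewrite inE xgs orbT.
Qed.

Lemma graded_take gs i : graded gs -> graded (take i gs).
Proof. by move=> h g /mem_take /h. Qed.

Lemma in_ideal_zcomp gs e p : graded gs -> in_ideal gs p -> in_ideal gs (zcomp e p).
Proof.
elim/last_ind: gs e p => [|gs g IH] e p.
  by rewrite !in_ideal_nil => _ ->; rewrite zcomp0.
move/graded_rcons => [hgs [d /zhomogP hg]]; rewrite !in_ideal_rcons => -[a pa].
by exists (zcomp (e - d%:Z) a); rewrite -(zcompM _ _ hg) -zcompB; apply: IH.
Qed.

(** Any multiplier of [g] can be replaced by its component of degree [e - d], since a graded ideal
    contains the components of its elements. *)
Lemma in_ideal_rcons_homog gs g (d : nat) e p :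
  graded gs -> g \is d.-homog -> zhomog e p -> in_ideal (rcons gs g) p ->
  exists2 a, zhomog (e - d%:Z) a & in_ideal gs (p - a * g).
Proof.
move=> hgs /zhomogP hg hp /in_ideal_rcons [a pa]; exists (zcomp (e - d%:Z) a).
  exact: zcomp_homog.
by rewrite -(zcompM _ _ hg) -{1}(zcomp_id hp) -zcompB; apply: in_ideal_zcomp.
Qed.

End Grading.

(** * Koszul cohomology *)

Section Koszul.
Variables (k : fieldType) (n : nat).
Local Notation S := {mpoly k[n]}.
Implicit Types (gs : seq S) (g x : S) (p e : int).

(** The exterior algebra on [r] generators as a free module, encoded by iterated pairs: all exterior
    degrees live in one module, and induction on [r] adjoins one linear form at a time. *)
Fixpoint koszul (r : nat) : lmodType S :=
  if r is r'.+1 then (koszul r' * koszul r')%type : lmodType S else S^o.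

Variable l : nat -> S.

(* In [(u, v) : koszul r.+1], [v] carries the factor e_r of the exterior
   algebra; [kdiff] is exterior multiplication by the sum of the [l i] e_i. *)
Fixpoint kdiff r : koszul r -> koszul r :=
  if r is r'.+1 then
    fun c : koszul r' * koszul r' => (kdiff c.1, l r' *: c.1 - kdiff c.2)
  else fun=> 0.

(* [c] is a cochain of exterior degree [p] with coefficients of degree [e]. *)
Fixpoint khomog r (p e : int) : koszul r -> Prop :=
  if r is r'.+1 then
    fun c : koszul r' * koszul r' => khomog p e c.1 /\ khomog (p - 1) e c.2
  else fun c : S => if p == 0 then zhomog e c else c = 0.

(** Cochains over the quotient ring are represented by cochains over [S]; [kin] says that such a
    representative vanishes modulo [gs]. *)
Fixpoint kin gs r : koszul r -> Prop :=
  if r is r'.+1 then fun c : koszul r' * koszul r' => kin gs c.1 /\ kin gs c.2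
  else fun c : S => in_ideal gs c.

Lemma kdiff_is_linear r : linear (@kdiff r).
Proof.
elim: r => [|r IH] a u v /=; first by rewrite scaler0 addr0.
rewrite !IH; apply: injective_projections => //=.
by rewrite scalerBr opprD !scalerDr !scalerA [l r * a]mulrC addrACA.
Qed.

Lemma kdiffD r (u v : koszul r) : kdiff (u + v) = kdiff u + kdiff v.
Proof. by have := kdiff_is_linear 1 u v; rewrite !scale1r. Qed.

Lemma kdiff0 r : kdiff (0 : koszul r) = 0.
Proof. by apply: (addIr (kdiff 0)); rewrite -kdiffD !add0r. Qed.

Lemma kdiffZ r a (u : koszul r) : kdiff (a *: u) = a *: kdiff u.
Proof. by have := kdiff_is_linear a u 0; rewrite kdiff0 !addr0. Qed.

Lemma kdiffN r (u : koszul r) : kdiff (- u) = - kdiff u.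
Proof. by rewrite -scaleN1r kdiffZ scaleN1r. Qed.

Lemma kdiffB r (u v : koszul r) : kdiff (u - v) = kdiff u - kdiff v.
Proof. by rewrite kdiffD kdiffN. Qed.

Lemma kdiff_kdiff r (c : koszul r) : kdiff (kdiff c) = 0.
Proof.
elim: r c => [//|r IH] c /=.
by rewrite kdiffB kdiffZ !IH subr0 subrr.
Qed.

Lemma khomog0 r p e : khomog p e (0 : koszul r).
Proof. by elim: r p => [|r IH] p /=; [case: ifP => // _; apply: zhomog0 | split]. Qed.

Lemma khomogD r p e (u v : koszul r) : khomog p e u -> khomog p e v -> khomog p e (u + v).
Proof.
elim: r p u v => [|r IH] p u v /=.
  by case: ifP => [_|_ -> ->]; [apply: zhomogD | rewrite addr0].
by case=> u1 u2 [v1 v2]; split; apply: IH.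
Qed.

Lemma khomogZ r p e e' a (u : koszul r) : zhomog e' a -> khomog p e u ->
  khomog p (e' + e) (a *: u).
Proof.
move=> ha; elim: r p u => [|r IH] p u /=.
  by case: ifP => [_|_ ->]; [apply: zhomogM | rewrite scaler0].
by case=> u1 u2; split; apply: IH.
Qed.

Lemma khomogN r p e (u : koszul r) : khomog p e u -> khomog p e (- u).
Proof.
elim: r p u => [|r IH] p u /=.
  by case: ifP => [_|_ ->]; [apply: zhomogN | rewrite oppr0].
by case=> u1 u2; split; apply: IH.
Qed.

Lemma khomogB r p e (u v : koszul r) : khomog p e u -> khomog p e v -> khomog p e (u - v).
Proof. by move=> hu hv; apply: khomogD => //; apply: khomogN. Qed.

Lemma khomog_lt0 r p e (u : koszul r) : p < 0 -> khomog p e u -> u = 0.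
Proof.
elim: r p u => [|r IH] p u p0 /=; first by case: ifP => // /eqP p00; rewrite p00 in p0.
by case: u => u v /= [/IH -> // /IH ->] //; lia.
Qed.

Lemma khomog_coef_lt0 r p e (u : koszul r) : e < 0 -> khomog p e u -> u = 0.
Proof.
move=> e0; elim: r p u => [|r IH] p u /=.
  by case: ifP => // _; apply: zhomog_lt0.
by case: u => u v /= [/IH -> /IH ->].
Qed.

Lemma khomog_diff r p e (c : koszul r) : (forall i, (i < r)%N -> zhomog 1 (l i)) ->
  khomog p e c -> khomog (p + 1) (e + 1) (kdiff c).
Proof.
elim: r p c => [|r IH] p c hl /=; first by move=> _; exact: (@khomog0 0).
have hl' i : (i < r)%N -> zhomog 1 (l i) by move=> ir; apply/hl/ltnW.
case=> c1 c2; split; first exact: IH.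
rewrite addrK; apply: khomogB; first by rewrite addrC; apply: khomogZ => //; apply: hl.
by rewrite -[p](subrK 1); apply: IH.
Qed.

Lemma kin0 gs r : kin gs (0 : koszul r).
Proof. by elim: r => [|r IH] /=; [apply: in_ideal0 | split]. Qed.

Lemma kinD gs r (u v : koszul r) : kin gs u -> kin gs v -> kin gs (u + v).
Proof.
elim: r u v => [|r IH] u v /=; first exact: in_idealD.
by case=> u1 u2 [v1 v2]; split; apply: IH.
Qed.

Lemma kinZ gs r a (u : koszul r) : kin gs u -> kin gs (a *: u).
Proof.
elim: r u => [|r IH] u /=; first exact: in_idealM.
by case=> u1 u2; split; apply: IH.
Qed.

Lemma kinB gs r (u v : koszul r) : kin gs u -> kin gs v -> kin gs (u - v).
Proof. by move=> hu hv; apply: kinD => //; rewrite -scaleN1r; apply: kinZ. Qed.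

Lemma kin_diff gs r (u : koszul r) : kin gs u -> kin gs (kdiff u).
Proof.
elim: r u => [|r IH] u /=; first by move=> _; exact: in_ideal0.
by case=> u1 u2; split; [apply: IH | apply: kinB; [apply: kinZ | apply: IH]].
Qed.

Lemma kin_rcons gs g r (u : koszul r) : kin gs u -> kin (rcons gs g) u.
Proof.
elim: r u => [|r IH] u /=; first exact: in_ideal_rconsl.
by case=> u1 u2; split; apply: IH.
Qed.

Lemma kin_reg gs g r (u : koszul r) :
  (forall a, in_ideal gs (a * g) -> in_ideal gs a) -> kin gs (g *: u) -> kin gs u.
Proof.
move=> reg; elim: r u => [|r IH] u /=; first by move=> Iu; apply: reg; rewrite mulrC.
by case=> u1 u2; split; apply: IH.
Qed.

Lemma kin_nil r (u : koszul r) : kin [::] u -> u = 0.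
Proof.
elim: r u => [|r IH] u /=; first by move/in_ideal_nil.
by case: u => u v /= [/IH -> /IH ->].
Qed.

Lemma kin_lift gs g (d : nat) r p e (u : koszul r) :
  graded gs -> g \is d.-homog -> khomog p e u -> kin (rcons gs g) u ->
  exists2 a : koszul r, khomog p (e - d%:Z) a & kin gs (u - g *: a).
Proof.
move=> hgs hg; elim: r p u => [|r IH] p u /=.
  case: ifP => [_ hu Iu|_ -> _].
    have [a ha Ia] := in_ideal_rcons_homog hgs hg hu Iu; exists a => //.
    by rewrite mulrC in Ia.
  by exists 0 => //; rewrite scaler0 subr0; apply: in_ideal0.
case=> u1 u2 [I1 I2].
have [a1 ha1 Ia1] := IH _ _ u1 I1; have [a2 ha2 Ia2] := IH _ _ u2 I2.
by exists (a1, a2).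
Qed.

(** [kbot] places a coefficient in exterior degree 0, and [ktop] places it on the product of all
    generators. *)
Fixpoint kbot (r : nat) : S -> koszul r :=
  if r is r'.+1 then fun g => (kbot r' g, 0) else fun g => g.

Fixpoint ktop (r : nat) : S -> koszul r :=
  if r is r'.+1 then fun g => (0, ktop r' g) else fun g => g.

Lemma khomog_bot r e g : zhomog e g -> khomog 0 e (kbot r g).
Proof. by move=> hg; elim: r => [|r IH] //=; split=> //; apply: khomog0. Qed.

Lemma khomog_top r e g : zhomog e g -> khomog r%:Z e (ktop r g).
Proof.
move=> hg; elim: r => [|r IH] //=; split; first exact: khomog0.
by rewrite -addn1 PoszD addrK.
Qed.

Lemma khomog_topE r e (c : koszul r) : khomog r%:Z e c ->
  exists2 g, zhomog e g & c = ktop r g.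
Proof.
(* The induction has to cover the exterior degrees above [r] as well, where cochains vanish: the
   first component of a pair has one degree too many for its module. *)
suff H s p : r%:Z + s%:Z = p -> khomog p e c ->
    if s == 0%N then exists2 g, zhomog e g & c = ktop r g else c = 0.
  by move/(H 0%N); apply; rewrite addr0.
elim: r s p c => [|r IH] s p c /=.
  rewrite add0r => <-; case: s => [|s] //= hc; by exists c.
case: c => u v /= ep [hu hv].
have -> : u = 0 by apply: (IH s.+1 p u _ hu); lia.
have {hv} : if s == 0%N then exists2 g, zhomog e g & v = ktop r g else v = 0.
  by apply: IH hv; lia.
case: (s == 0%N) => [[g hg ->]|-> //]; by exists g.
Qed.

Lemma ktopZB r a g h : ktop r (a * g - h) = a *: ktop r g - ktop r h.
Proof.
elim: r => [|r IH] //=; rewrite IH; apply: injective_projections => //=.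
by rewrite scaler0 subr0.
Qed.

Lemma ktop0 r : ktop r 0 = 0.
Proof. by elim: r => [|r IH] //=; rewrite IH. Qed.

Lemma ktop_inj r : injective (ktop r).
Proof. by elim: r => [|r IH] g h //= [] /IH. Qed.

Lemma kdiff_top r g : kdiff (ktop r g) = 0.
Proof. by elim: r => [|r IH] //=; rewrite kdiff0 IH scaler0 subr0. Qed.

(** Together with [ktop_boundary] this identifies the top cohomology with the quotient of [S] by the
    linear forms. *)
Lemma kdiff_subtop r e (b : koszul r) : khomog (r%:Z - 1) e b ->
  exists2 g, in_ideal (mkseq l r) g & kdiff b = ktop r g.
Proof.
elim: r b => [|r IH] b; first by exists 0 => //; apply: in_ideal0.
case: b => u v /= [hu hv]; rewrite -addn1 PoszD addrK in hu hv.
have [g0 _ ->] := khomog_topE hu; have [g1 Ig1 ->] := IH _ hv.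
exists (l r * g0 - g1); last by rewrite kdiff_top ktopZB.
rewrite mkseqS; apply: in_idealB; last exact: in_ideal_rconsl.
by rewrite mulrC; apply/in_idealM/in_ideal_rconsr.
Qed.

Hypothesis hom_l : forall i, l i \is 1.-homog.

Lemma graded_l r : graded (mkseq l r).
Proof. by move=> g /mapP [i _ ->]; exists 1%N; apply: hom_l. Qed.

Lemma ktop_boundary r e g : zhomog e g -> in_ideal (mkseq l r) g ->
  exists2 b : koszul r, khomog (r%:Z - 1) (e - 1) b & kdiff b = ktop r g.
Proof.
elim: r g => [|r IH] g hg.
  move/in_ideal_nil => ->; exists 0; first exact: (@khomog0 0).
  by rewrite kdiff0 ktop0.
rewrite mkseqS => Ig.
have [a ha Iag] := in_ideal_rcons_homog (@graded_l r) (hom_l r) hg Ig.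
have [] := IH (g - a * l r) _ Iag.
  apply: zhomogD => //; apply: zhomogN; rewrite -[e](subrK 1).
  by apply: zhomogM => //; apply: (dhomog_zhomog (hom_l _)).
(* The first component contributes [a * l r] to the top coefficient, the second one the remainder
   [g - a * l r]; the sign of [- b] cancels the sign in [kdiff]. *)
move=> b hb eb; exists (ktop r a, - b : koszul r).
  have rS : r.+1%:Z - 1 = r%:Z by lia.
  by split; rewrite rS; [apply: khomog_top | apply: khomogN].
rewrite /= kdiff_top kdiffN eb opprK; congr pair.
rewrite -[g]mul1r ktopZB scale1r mul1r -[a * l r]subr0 [a * _]mulrC ktopZB.
by rewrite ktop0 subr0 addrC subrK.
Qed.

(** Induction on the number of forms: a cocycle [(u, v)] is a boundary as soon as [u] is one. Below
    degree [r] this is the induction hypothesis; in degree [r] the cocycle equation puts [l r] times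
    the top coefficient of [u] into the ideal of the earlier forms, and regularity removes [l r]. *)
Lemma koszul_exact r p e (c : koszul r) :
  (forall i, (i < r)%N -> forall g,
     in_ideal (mkseq l i) (g * l i) -> in_ideal (mkseq l i) g) ->
  p < r%:Z -> khomog p e c -> kdiff c = 0 ->
  exists2 b : koszul r, khomog (p - 1) (e - 1) b & c = kdiff b.
Proof.
move=> reg; elim: r p e reg c => [|r IH] p e reg c pr hc dc.
  by exists 0; [apply: khomog0 | rewrite kdiff0 (khomog_lt0 pr hc)].
have {}IH p' e' c' := IH p' e' (fun i ir => reg i (ltnW ir)) c'.
case: c hc dc => u v /= [hu hv] [du dv].
(* Given [u'], the difference [v - l r *: u'] is a cocycle of exterior degree [p - 1 < r], hence a
   boundary by induction. *)
suff [u' hu' eu] : exists2 u' : koszul r, khomog (p - 1) (e - 1) u' & u = kdiff u'.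
  have [|||w hw ew] := IH (p - 1) e (v - l r *: u').
  - by lia.
  - apply: khomogB => //; rewrite -[e](subrK 1) [_ + 1]addrC; apply: khomogZ => //.
    exact: (dhomog_zhomog (hom_l _)).
  - by rewrite kdiffB kdiffZ -eu -opprB dv oppr0.
  exists (u', - w : koszul r); first by split=> //; apply: khomogN.
  by rewrite /= -eu kdiffN -ew opprK addrC subrK.
have [pr'|rp] := ltrP p r%:Z; first exact: IH.
have {pr rp} pE : p = r%:Z by lia.
rewrite {}pE in hu hv *.
have [g hg ug] := khomog_topE hu; have [h Ih vh] := kdiff_subtop hv.
have lg : l r * g = h.
  apply: (@ktop_inj r); rewrite -vh -[l r * g]subr0 ktopZB ktop0 subr0 -ug.
  exact: subr0_eq.
have [|b hb eb] := @ktop_boundary r _ _ hg; last by exists b => //; rewrite ug eb.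
by apply: reg => //; rewrite mulrC lg.
Qed.

End Koszul.

(** * Koszul cohomology modulo a regular sequence *)

Section Vanishing.
Variables (k : fieldType) (n : nat).
Local Notation S := {mpoly k[n]}.
Variables (l : nat -> S) (r : nat) (fs : seq S) (d : nat -> nat).
Hypothesis hom_l : forall i, l i \is 1.-homog.
Hypothesis reg_l : forall i, (i < r)%N -> forall g,
  in_ideal (mkseq l i) (g * l i) -> in_ideal (mkseq l i) g.
Hypothesis hom_fs : forall i, (i < size fs)%N -> fs`_i \is (d i).-homog.
Hypothesis reg_fs : regular_seq fs.
Hypothesis d_mono : forall i j, (i <= j < size fs)%N -> (d i <= d j)%N.

Lemma graded_fs s : graded (take s fs).
Proof.
apply: graded_take => g gfs; exists (d (index g fs)).
by have := @hom_fs (index g fs); rewrite index_mem nth_index //; apply.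
Qed.

(* Vanishing of the Koszul cohomology of [l] with values in S/(f_1..f_s): by
   the long exact sequence of multiplication by f_s, nonzero classes of
   codegree [q] only occur if [q <= s], and then have total degree at least
   the sum of the [q] smallest degrees. *)
Lemma koszul_vanish s q p e (c : koszul k n r) :
  (s <= size fs)%N -> p + q%:Z = r%:Z -> khomog p e c ->
  kin (take s fs) (kdiff l c) ->
  (s < q)%N \/ e + q%:Z < (\sum_(i < q) d i)%N%:Z ->
  exists2 b : koszul k n r, khomog (p - 1) (e - 1) b &
    kin (take s fs) (c - kdiff l b).
Proof.
elim: s q p e c => [|s IH] q p e c ssz pq hc Ic cond.
(* For [q = 0] the alternative on [s] is impossible and the other one says [e < 0], so that [c] is
   zero. *)
all: have [q0|q0] := posnP q; first (exists 0; first exact: khomog0).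
- rewrite kdiff0 subr0 (khomog_coef_lt0 _ hc); first exact: kin0.
  by case: cond; rewrite q0 // big_ord0; lia.
- rewrite take0 in Ic *; have [||b hb ->] := koszul_exact hom_l reg_l _ hc.
  + by lia.
  + exact: kin_nil Ic.
  by exists b => //; rewrite subrr; apply: kin0.
- rewrite kdiff0 subr0 (khomog_coef_lt0 _ hc); first exact: kin0.
  by case: cond; rewrite q0 // big_ord0; lia.
have hl i : (i < r)%N -> zhomog 1 (l i) by move=> _; apply: (dhomog_zhomog (hom_l _)).
rewrite (take_nth 0) // in Ic *; set f := fs`_s in Ic *.
have hf : f \is (d s).-homog by apply: hom_fs.
(* Modulo the first [s] forms, [kdiff c] is [f *: a]: the class of [a] is the image of [c] under the
   connecting map. It has exterior degree one higher, hence codegree [q.-1]. *)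
have [a ha Ia] := kin_lift (@graded_fs s) hf (khomog_diff hl hc) Ic.
have regf h : in_ideal (take s fs) (h * f) -> in_ideal (take s fs) h.
  exact: (proj2 reg_fs).
have Ida : kin (take s fs) (kdiff l a).
  apply: kin_reg regf _; have := kin_diff l Ia.
  rewrite kdiffB kdiff_kdiff sub0r kdiffZ => /(kinZ (-1)).
  by rewrite scaleN1r opprK.
have [||b hb Ib] := IH q.-1 _ _ a (ltnW ssz) _ ha Ida.
- by lia.
(* The degree of [a] has dropped by [d s], which is at least the summand [d q.-1] removed from the
   bound, by monotonicity. *)
- have [/=|qs] := ltnP s q.-1; [by left | right].
  case: cond => [|]; first by lia.
  have -> : (\sum_(i < q) d i = \sum_(i < q.-1) d i + d q.-1)%N.
    by case: (q) q0 => // q' _; rewrite big_ord_recr.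
  have /d_mono : (q.-1 <= s < size fs)%N by rewrite qs.
  by lia.
rewrite addrK in hb.
have hfb : khomog p e (f *: b).
  rewrite -[e](subrK (d s)%:Z) [_ + (d s)%:Z]addrC; apply: khomogZ.
    exact/zhomogP.
  by rewrite addrAC addrK in hb.
(* Since [a] is the boundary of [b], the corrected cochain is a cocycle already modulo the first [s]
   forms. *)
have [|||b' hb' Ib'] := IH q p e (c - f *: b) (ltnW ssz) pq.
- exact: khomogB.
- rewrite kdiffB kdiffZ -[kdiff l c](subrK (f *: a)) -addrA -scalerBr.
  by apply: kinD => //; apply: kinZ.
- by case: cond => [sq|]; [left; apply: ltnW | right].
exists b' => //; rewrite -[c](subrK (f *: b)) addrAC; apply: kinD.
  exact: kin_rcons.
elim: (r) (b) => [|r' IHr] /= u; last by split; apply: IHr.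
by rewrite [_ *: _]mulrC; apply/in_idealM/in_ideal_rconsr.
Qed.

Lemma kbotZ m a g : a *: kbot m g = kbot m (a * g) :> koszul k n m.
Proof. by elim: m => [|m IH] //=; rewrite -IH; congr pair; apply: scaler0. Qed.

Lemma kin_bot gs m g : in_ideal gs g <-> kin gs (kbot m g : koszul k n m).
Proof. by elim: m => [|m IH] //=; split=> [/IH|[/IH]] //; split=> //; apply: kin0. Qed.

Lemma kin_diff_bot gs g :
  (forall i, (i < r)%N -> in_ideal gs (l i * g)) -> kin gs (kdiff l (kbot r g)).
Proof.
elim: (r) => [|r' IH] lg /=; first exact: in_ideal0.
split; first by apply: IH => i ir; apply/lg/ltnW.
by rewrite kdiff0 subr0 kbotZ; apply/kin_bot/lg.
Qed.

(** [G] in exterior degree 0 is a cocycle modulo [fs], of codegree [r]. If the bound failed it would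
    be a boundary, but there are no nonzero cochains of exterior degree -1, so [G] would lie in the
    ideal. *)
Lemma annihilator_degree (E : nat) G :
  G \is E.-homog -> (forall i, (i < r)%N -> in_ideal fs (l i * G)) ->
  ~ in_ideal fs G -> (\sum_(i < r) d i <= E + r)%N.
Proof.
move=> hG lG nG; rewrite leqNgt; apply/negP => lt; apply: nG.
have hc := khomog_bot r (dhomog_zhomog hG).
have := @koszul_vanish (size fs) r 0 E _ (leqnn _) (add0r _) hc.
rewrite take_size => /(_ (kin_diff_bot lG) (or_intror lt)) [b hb].
rewrite (khomog_lt0 _ hb) // kdiff0 subr0.
by move/kin_bot.
Qed.

End Vanishing.

(** * Monomial ideals and linear substitutions *)

Section MonomialIdeals.
Variables (k : fieldType) (n : nat).
Local Notation S := {mpoly k[n]}.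
Implicit Types (us : seq 'X_{1..n}) (u v w : 'X_{1..n}) (p g : S).

Definition monomials us : seq S := [seq 'X_[u] | u <- us].

Lemma in_monomial_ideal us p : in_ideal (monomials us) p <->
  forall w, p@_w != 0 -> has (fun u => (u <= w)%MM) us.
Proof.
split=> [|sp].
  elim/last_ind: us p => [|us u IH] p.
    by move/in_ideal_nil=> -> w; rewrite mcoeff0 eqxx.
  rewrite /monomials map_rcons => /in_ideal_rcons [a /IH pa] w pw.
  rewrite has_rcons; have [//|/= nuw] := boolP (u <= w)%MM.
  apply: pa; rewrite mcoeffB [(a * _)@_w]memN_msupp_eq0 ?subr0 //.
  apply: contra nuw => /msuppM_le /allpairsP [[x y] /= [_ + ->]].
  by rewrite msuppX inE => /eqP ->; apply: lem_addl.
rewrite [p]mpolyE big_seq; apply: in_ideal_sum => w.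
rewrite mcoeff_msupp => /sp /hasP [u uus uw]; apply: in_idealZ.
rewrite -(submK uw) mpolyXD; apply/in_idealM/in_ideal_mem.
by apply/mapP; exists u.
Qed.

Lemma in_monomial_idealX us w :
  in_ideal (monomials us) 'X_[w] <-> has (fun u => (u <= w)%MM) us.
Proof.
rewrite in_monomial_ideal; split=> [|uw v]; first by apply; rewrite mcoeffX eqxx oner_neq0.
by rewrite mcoeffX; case: (w =P v) => [<-|_]; rewrite ?eqxx.
Qed.

(** A monomial that divides [v + w] and shares no variable with [v] already divides [w]. *)
Lemma monomial_regular us v g :
  (forall u, u \in us -> forall i, u i = 0%N \/ v i = 0%N) ->
  in_ideal (monomials us) (g * 'X_[v]) -> in_ideal (monomials us) g.
Proof.
move=> disj /in_monomial_ideal gv; apply/in_monomial_ideal => w gw.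
have /hasP [u uus /mnm_lepP uw] : has (fun u => (u <= v + w)%MM) us.
  by apply: gv; rewrite mcoeffMX.
apply/hasP; exists u => //; apply/mnm_lepP => i.
have := uw i; rewrite mnmDE; case: (disj u uus i) => -> //.
Qed.

Lemma pure_powersE (d : 'I_n -> nat) :
  pure_powers k d = monomials [seq (U_(i) *+ d i)%MM | i <- enum 'I_n].
Proof. by rewrite /monomials -map_comp; apply: eq_map => i /=; rewrite mpolyXn. Qed.

Lemma pure_power_lem (d : 'I_n -> nat) i w : (U_(i) *+ d i <= w)%MM = (d i <= w i)%N.
Proof.
apply/mnm_lepP/idP => [/(_ i)|h j]; rewrite mulmnE mnm1E ?eqxx ?mul1n //.
by have [<-|] := eqVneq i j; rewrite ?mul1n.
Qed.

Lemma regular_pure_powers (d : 'I_n -> nat) :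
  (forall i, (0 < d i)%N) -> regular_seq (pure_powers k d).
Proof.
move=> d0; rewrite pure_powersE; split.
  rewrite -mpolyX0 => /in_monomial_idealX /hasP [u /mapP [i _ ->]].
  by rewrite pure_power_lem mnm0E leqNgt d0.
move=> i; rewrite /monomials 2!size_map size_enum_ord => ilt g; pose e := Ordinal ilt.
rewrite -2!map_take (nth_map 0%MM) 1?size_map ?size_enum_ord //.
rewrite (nth_map e) ?size_enum_ord //.
have -> : nth e (enum 'I_n) i = e by apply: val_inj; rewrite /= nth_enum_ord.
apply: monomial_regular => u /mapP [j /(nthP e) [m]].
rewrite size_take size_enum_ord ilt => mi.
rewrite nth_take // => jE -> x; rewrite !mulmnE !mnm1E.
have jm : j = m :> nat by rewrite -jE nth_enum_ord // (ltn_trans mi).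
have [xe|] := eqVneq e x; last by right.
left; case: eqVneq => // jx.
by move: mi; rewrite -jm jx -xe ltnn.
Qed.

End MonomialIdeals.

(** * Linear forms and linear changes of variables *)

Section LinearForms.
Variables (k : fieldType) (n : nat).
Local Notation S := {mpoly k[n]}.

Lemma in_ideal_rmorph (phi : {rmorphism S -> S}) gs p :
  in_ideal gs p -> in_ideal (map phi gs) (phi p).
Proof.
elim/last_ind: gs p => [|gs g IH] p.
  by move/in_ideal_nil => ->; rewrite rmorph0; apply: in_ideal0.
move/in_ideal_rcons => [a /IH]; rewrite map_rcons rmorphB rmorphM => h.
by apply/in_ideal_rcons; exists (phi a).
Qed.

Lemma regular_rmorph (phi psi : {rmorphism S -> S}) gs :
  cancel phi psi -> cancel psi phi -> regular_seq gs -> regular_seq (map phi gs).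
Proof.
move=> phiK psiK [n1 reg].
have psi_map hs : map psi (map phi hs) = hs.
  by rewrite -map_comp -[RHS]map_id; apply: eq_map.
split=> [/(in_ideal_rmorph psi)|i]; first by rewrite psi_map rmorph1.
rewrite size_map => ilt g; rewrite -map_take (nth_map 0) //.
move/(in_ideal_rmorph psi); rewrite rmorphM psi_map phiK => /(reg i ilt).
by move/(in_ideal_rmorph phi); rewrite psiK.
Qed.

Definition linform (v : 'rV[k]_n) : S := \sum_j v 0 j *: 'X_j.

Definition lin_subst (A : 'M[k]_n) : n.-tuple S := [tuple linform (row i A) | i < n].

Lemma linform_homog v : linform v \is 1.-homog.
Proof. by apply: rpred_sum => j _; apply: rpredZ; rewrite dhomogX; apply/eqP/mdeg1. Qed.

Lemma lin_substX A (i : 'I_n) : 'X_i \mPo lin_subst A = linform (row i A).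
Proof. by rewrite comp_mpolyXU (nth_map i) ?size_enum_ord // nth_ord_enum. Qed.

Lemma lin_subst_linform A v : linform v \mPo lin_subst A = linform (v *m A).
Proof.
rewrite /linform raddf_sum /=.
under eq_bigr => j _ do rewrite comp_mpolyZ lin_substX scaler_sumr.
rewrite exchange_big; apply: eq_bigr => i _ /=; rewrite [in RHS]mxE scaler_suml.
by apply: eq_bigr => j _; rewrite mxE scalerA.
Qed.

Lemma lin_substM A B p : (p \mPo lin_subst A) \mPo lin_subst B = p \mPo lin_subst (A *m B).
Proof.
rewrite (comp_mpolyEX p (lin_subst A)) (comp_mpolyEX p (lin_subst (A *m B))).
rewrite raddf_sum; apply: eq_bigr => m _ /=; rewrite !comp_mpolyZ; congr (_ *: _).
rewrite mpolyXE_id !rmorph_prod /=.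
apply: eq_bigr => i _; rewrite !rmorphXn /=; congr (_ ^+ _).
by rewrite !lin_substX lin_subst_linform -row_mul.
Qed.

Lemma lin_subst1 p : p \mPo lin_subst 1%:M = p.
Proof.
rewrite -[RHS]comp_mpoly_id; congr comp_mpoly; apply: eq_from_tnth => i.
rewrite !tnth_mktuple /linform (bigD1 i) //= !mxE eqxx scale1r big1 ?addr0 // => j ji.
by rewrite !mxE eq_sym (negPf ji) scale0r.
Qed.

Definition linforms (A : 'M[k]_n) : seq S := [seq linform (row i A) | i <- enum 'I_n].

(** The variables are regular, being pure powers with exponent 1, and substitution by [A] is an
    automorphism carrying them to the rows of [A]. *)
Lemma regular_linforms A : A \in unitmx -> regular_seq (linforms A).
Proof.
move=> uA; have := @regular_pure_powers k n (fun=> 1%N) (fun=> erefl).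
move/(@regular_rmorph (comp_mpoly (lin_subst A)) (comp_mpoly (lin_subst (invmx A)))).
rewrite -map_comp (eq_map (g := fun i => linform (row i A))); last first.
  by move=> i /=; rewrite expr1 lin_substX.
by apply=> p /=; rewrite lin_substM (mulmxV, mulVmx) // lin_subst1.
Qed.

(** Independence of the [r] annihilating forms is expressed by completing them to an invertible
    matrix, which makes them an initial segment of a regular sequence. *)
Lemma annihilator_rank (A : 'M[k]_n) (r : nat) (fs : seq S) (d : nat -> nat) (E : nat) G :
  A \in unitmx -> (r <= n)%N ->
  (forall i, (i < size fs)%N -> fs`_i \is (d i).-homog) -> regular_seq fs ->
  (forall i j, (i <= j < size fs)%N -> (d i <= d j)%N) ->
  G \is E.-homog ->
  (forall i : 'I_n, (i < r)%N -> in_ideal fs (linform (row i A) * G)) ->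
  ~ in_ideal fs G -> (\sum_(i < r) d i <= E + r)%N.
Proof.
move=> uA rn hfs rfs dm hG AG nG.
have sz : size (linforms A) = n by rewrite size_map size_enum_ord.
have nthl (i : 'I_n) : (linforms A)`_i = linform (row i A).
  by rewrite (nth_map i) ?size_enum_ord // nth_ord_enum.
apply: (@annihilator_degree k n (nth 0 (linforms A)) r fs d _ _ hfs rfs dm) hG _ nG.
(* From index [n] on the family takes the default value 0, which is homogeneous of every degree. *)
- move=> i; have [lt|ge] := ltnP i n; last by rewrite nth_default ?sz // rpred0.
  by rewrite (nthl (Ordinal lt)) linform_homog.
- move=> i ir g; have ilt := leq_trans ir rn.
  have -> : mkseq (nth 0 (linforms A)) i = take i (linforms A).
    by rewrite /mkseq map_nth_iota0 // sz ltnW.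
  by apply: (proj2 (regular_linforms uA)); rewrite sz.
- move=> i ir; have ilt := leq_trans ir rn.
  by rewrite (nthl (Ordinal ilt)); apply: AG.
Qed.

End LinearForms.

(** * Hilbert functions *)

Section NatSup.
Variable P : nat -> Prop.

Lemma decPP (Q : Prop) : reflect Q (Defs.decP Q).
Proof.
by rewrite /Defs.decP; case: ClassicalEpsilon.excluded_middle_informative; constructor.
Qed.

Lemma natsup_le N : (forall r, P r -> (r <= N)%N) -> (natsup P <= N)%N.
Proof.
move=> bP; rewrite /natsup; case: ClassicalEpsilon.excluded_middle_informative => // h.
by apply/bigmax_leqP => i /decPP /bP.
Qed.

Lemma leq_natsup N r : (forall s, P s -> (s <= N)%N) -> P r -> (r <= natsup P)%N.
Proof.
move=> bP Pr; rewrite /natsup.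
case: ClassicalEpsilon.excluded_middle_informative => [h|[]]; last by exists N.
case: ClassicalEpsilon.constructive_indefinite_description => M /= bM.
have rM : (r < M.+1)%N by rewrite ltnS bM.
by apply: (leq_bigmax_cond (Ordinal rM)); apply/decPP.
Qed.

Lemma natsup_mem N r : (forall s, P s -> (s <= N)%N) -> P r -> P (natsup P).
Proof.
move=> bP Pr; rewrite /natsup.
case: ClassicalEpsilon.excluded_middle_informative => [h|[]]; last by exists N.
case: ClassicalEpsilon.constructive_indefinite_description => M /= bM.
have rM : (r < M.+1)%N by rewrite ltnS bM.
have [|i iP ->] := @eq_bigmax_cond _ [pred i : 'I_M.+1 | Defs.decP (P i)] (@nat_of_ord _).
  by apply/card_gt0P; exists (Ordinal rM); apply/decPP.
exact/decPP.
Qed.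

End NatSup.

(** * Linear independence and spanning modulo an ideal *)

Section LinearIndependence.
Variables (k : fieldType) (n : nat).
Local Notation S := {mpoly k[n]}.
Implicit Types (gs ps qs : seq S) (p q g : S) (c : seq k).

Definition lcomb c ps : S := \sum_(i < size ps) c`_i *: ps`_i.

(** Coefficients form a row vector here, so that matrix ranks can be used. *)
Definition vcomb r (v : 'rV[k]_r) (F : 'I_r -> S) : S := \sum_i v 0 i *: F i.

Definition seq_fun ps (i : 'I_(size ps)) : S := ps`_i.

Definition spanned gs ps p :=
  exists2 c, size c = size ps & in_ideal gs (p - lcomb c ps).

Lemma lcomb_vcomb ps (v : 'rV[k]_(size ps)) :
  exists2 c, size c = size ps & (forall i : 'I_(size ps), c`_i = v 0 i) /\
    lcomb c ps = vcomb v (seq_fun (ps := ps)).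
Proof.
have cE (i : 'I_(size ps)) : [seq v 0 i | i <- enum 'I_(size ps)]`_i = v 0 i.
  by rewrite (nth_map i) ?size_enum_ord // nth_ord_enum.
exists [seq v 0 i | i <- enum 'I_(size ps)]; first by rewrite size_map size_enum_ord.
by split=> //; apply: eq_bigr => i _; rewrite cE.
Qed.

Lemma vcomb_lcomb c ps : lcomb c ps = vcomb (\row_i c`_i) (seq_fun (ps := ps)).
Proof. by apply: eq_bigr => i _; rewrite mxE. Qed.

Lemma lin_indepP gs ps : lin_indep_mod gs ps <->
  forall v : 'rV[k]_(size ps), in_ideal gs (vcomb v (seq_fun (ps := ps))) -> v = 0.
Proof.
split=> [ind v|ind c sc Ic i ilt].
  have [c sc [cE <-]] := lcomb_vcomb v => /(ind c sc) c0.
  by apply/rowP => i; rewrite mxE -cE c0.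
have := ind (\row_i c`_i); rewrite -vcomb_lcomb => /(_ Ic) /rowP /(_ (Ordinal ilt)).
by rewrite !mxE.
Qed.

Lemma spannedP gs ps p : spanned gs ps p <->
  exists v : 'rV[k]_(size ps), in_ideal gs (p - vcomb v (seq_fun (ps := ps))).
Proof.
split=> [[c sc Ic]|[v]].
  by exists (\row_i c`_i); rewrite -vcomb_lcomb.
by have [c sc [_ <-]] := lcomb_vcomb v => Iv; exists c.
Qed.

Lemma vcombM gs r s (F : 'I_r -> S) (H : 'I_s -> S) (M : 'M[k]_(r, s)) (v : 'rV_r) :
  (forall i, in_ideal gs (F i - vcomb (row i M) H)) ->
  in_ideal gs (vcomb v F - vcomb (v *m M) H).
Proof.
move=> IM; have -> : vcomb (v *m M) H = \sum_i v 0 i *: vcomb (row i M) H.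
  under [RHS]eq_bigr => i _ do rewrite scaler_sumr.
  rewrite exchange_big; apply: eq_bigr => j _ /=; rewrite mxE scaler_suml.
  by apply: eq_bigr => i _; rewrite mxE scalerA.
rewrite -sumrB; apply: in_ideal_sum => i _; rewrite -scalerBr.
exact: in_idealZ.
Qed.

Lemma vcomb0 r (F : 'I_r -> S) : vcomb 0 F = 0.
Proof. by apply: big1 => i _; rewrite mxE scale0r. Qed.

Lemma coord_matrix gs r (F : 'I_r -> S) qs : (forall i, spanned gs qs (F i)) ->
  exists M : 'M[k]_(r, size qs),
    forall i, in_ideal gs (F i - vcomb (row i M) (seq_fun (ps := qs))).
Proof.
move=> sp; have /fin_all_exists [f fP] : forall i, exists v : 'rV[k]_(size qs),
    in_ideal gs (F i - vcomb v (seq_fun (ps := qs))) by move=> i; apply/spannedP.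
exists (\matrix_i f i) => i; rewrite rowK; exact: fP.
Qed.

Lemma indep_coord_free gs ps qs (M : 'M[k]_(size ps, size qs)) :
  lin_indep_mod gs ps ->
  (forall i, in_ideal gs (seq_fun i - vcomb (row i M) (seq_fun (ps := qs)))) ->
  row_free M.
Proof.
move=> /lin_indepP ind IM; rewrite -kermx_eq0; apply/rowV0P => v /sub_kermxP vM.
by apply: ind; have := vcombM v IM; rewrite vM vcomb0 subr0.
Qed.

(** The coordinates of [ps] with respect to [qs] form a matrix of full row rank, which has at least
    as many columns as rows. *)
Lemma indep_size_le gs ps qs : lin_indep_mod gs ps ->
  (forall p, p \in ps -> spanned gs qs p) -> (size ps <= size qs)%N.
Proof.
move=> ind sp; have [|M IM] := @coord_matrix gs _ (seq_fun (ps := ps)) qs.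
  by move=> i; apply/sp/mem_nth.
by have /eqP <- := indep_coord_free ind IM; apply: rank_leq_col.
Qed.

Lemma lcomb_cat c1 c2 ps1 ps2 : size c1 = size ps1 ->
  lcomb (c1 ++ c2) (ps1 ++ ps2) = lcomb c1 ps1 + lcomb c2 ps2.
Proof.
move=> sc; rewrite /lcomb size_cat big_split_ord /=; congr (_ + _).
  by apply: eq_bigr => i _; rewrite !nth_cat sc ltn_ord.
by apply: eq_bigr => i _; rewrite !nth_cat sc ltnNge leq_addr /= addKn.
Qed.

Lemma lcomb1 a p : lcomb [:: a] [:: p] = a *: p.
Proof. by rewrite /lcomb big_ord1. Qed.

Lemma lcomb_map_mul c ps g : lcomb c (map ( *%R^~ g) ps) = lcomb c ps * g.
Proof.
rewrite /lcomb size_map mulr_suml; apply: eq_bigr => i _.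
by rewrite (nth_map 0) // scalerAl.
Qed.

Lemma lin_indep_cat gs ps qs : lin_indep_mod gs qs ->
  (forall c1 c2, size c1 = size ps -> size c2 = size qs ->
     in_ideal gs (lcomb c1 ps + lcomb c2 qs) -> c1 = nseq (size ps) 0) ->
  lin_indep_mod gs (ps ++ qs).
Proof.
move=> indq ind c; rewrite size_cat -[c](cat_take_drop (size ps)) => sc Ic.
have s1 : size (take (size ps) c) = size ps.
  rewrite size_takel // (@leq_trans (size ps + size qs)) ?leq_addr //.
  by rewrite -sc cat_take_drop.
have s2 : size (drop (size ps) c) = size qs.
  by apply: (@addnI (size ps)); rewrite -{1}s1 -size_cat.
have {}Ic : in_ideal gs (lcomb (take (size ps) c ++ drop (size ps) c) (ps ++ qs)).
  by rewrite /lcomb size_cat.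
rewrite lcomb_cat // in Ic; have c0 := ind _ _ s1 s2 Ic; rewrite c0 in Ic *.
have l0 : lcomb (nseq (size ps) 0) ps = 0.
  by apply: big1 => i _; rewrite nth_nseq ltn_ord scale0r.
rewrite l0 add0r in Ic; move=> i ilt; rewrite nth_cat size_nseq nth_nseq.
case: ltnP => // pi; apply: (indq _ s2 Ic).
by rewrite ltn_subLR.
Qed.

Lemma lin_indep_cons gs p ps : lin_indep_mod gs ps -> ~ spanned gs ps p ->
  lin_indep_mod gs (p :: ps).
Proof.
move=> ind nsp; rewrite -cat1s; apply: lin_indep_cat => // -[|a []] // c _ sc.
rewrite lcomb1 => Ic; have [->//|a0] := eqVneq a 0; case: nsp.
exists [seq - a^-1 * x | x <- c]; first by rewrite size_map.
have -> : lcomb [seq - a^-1 * x | x <- c] ps = - a^-1 *: lcomb c ps.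
  rewrite /lcomb scaler_sumr; apply: eq_bigr => i _.
  by rewrite (nth_map 0) ?sc // scalerA.
rewrite scaleNr opprK -[p]scale1r -(mulVf a0) -scalerA -scalerDr.
exact: in_idealZ.
Qed.

Lemma lin_indep_sub gs gs' ps : (forall p, in_ideal gs p -> in_ideal gs' p) ->
  lin_indep_mod gs' ps -> lin_indep_mod gs ps.
Proof. by move=> sub ind c sc /sub; apply: ind. Qed.

End LinearIndependence.

(** * Bases of graded pieces and the effect of adding a form *)

Section HilbertFunction.
Variables (k : fieldType) (n : nat).
Local Notation S := {mpoly k[n]}.
Implicit Types (gs ps qs : seq S) (p q g : S) (c : seq k) (m d : nat).

Definition forms m ps := all (fun p => p \is m.-homog) ps.

Lemma forms_lcomb m ps c : forms m ps -> lcomb c ps \is m.-homog.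
Proof. by move=> hps; apply: rpred_sum => i _; apply/rpredZ/(allP hps)/mem_nth. Qed.

Lemma spanned_monomials gs (us : seq 'X_{1..n}) p : uniq us ->
  (forall w, p@_w != 0 -> w \in us \/ in_ideal gs 'X_[w]) ->
  spanned gs (monomials k us) p.
Proof.
move=> uus pus; exists [seq p@_w | w <- us]; first by rewrite !size_map.
have -> : lcomb [seq p@_w | w <- us] (monomials k us) = \sum_(w <- us) p@_w *: 'X_[w].
  rewrite /lcomb size_map (big_nth 0%MM) big_mkord; apply: eq_bigr => i _.
  by rewrite !(nth_map 0%MM).
apply: (@in_ideal_subset _ _ (monomials k [seq w <- msupp p | w \notin us])).
  move=> g /mapP [w]; rewrite mem_filter mcoeff_msupp => /andP [nw pw ->].
  by case: (pus w pw) => // wus; rewrite wus in nw.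
apply/in_monomial_ideal => w pw; apply/hasP; exists w; last exact: lepm_refl.
rewrite mem_filter mcoeff_msupp.
have : (p - \sum_(v <- us) p@_v *: 'X_[v])@_w = if w \in us then 0 else p@_w.
  rewrite mcoeffB raddf_sum /=.
  under eq_bigr => v _ do rewrite mcoeffZ mcoeffX.
  case: ifP => wus.
    rewrite (bigD1_seq w) //= eqxx mulr1 big1 ?addr0 ?subrr // => v /negPf ->.
    by rewrite mulr0.
  rewrite big_seq big1 ?subr0 // => v vus; case: eqP => [vw|]; rewrite ?mulr0 //.
  by rewrite -vw vus in wus.
by move: pw => /[swap] ->; case: ifP; rewrite ?eqxx.
Qed.

(** The finitely many monomials of degree at most [m] span all forms of degree [m]. This excludes
    the default value 0 of [natsup] on unbounded sets. *)
Lemma HF_bounded gs m : exists N, forall r, (exists ps, [/\ size ps = r, forms m ps &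
  lin_indep_mod gs ps]) -> (r <= N)%N.
Proof.
pose us := [seq bmnm w | w <- enum {: 'X_{1..n < m.+1}}].
exists (size (monomials k us)) => _ [ps [<- hps ind]].
apply: indep_size_le ind _ => p /(allP hps) /dhomogP hp; apply: spanned_monomials.
  by rewrite map_inj_uniq ?enum_uniq //; apply: val_inj.
move=> w; rewrite -mcoeff_msupp => /hp wm; left; apply/mapP.
have wlt : (mdeg w < m.+1)%N by rewrite wm.
by exists (BMultinom wlt); rewrite ?mem_enum.
Qed.

Lemma leq_HF gs m ps : forms m ps -> lin_indep_mod gs ps -> (size ps <= HF gs m)%N.
Proof. by have [N bN] := HF_bounded gs m => hps ind; apply: (leq_natsup bN); exists ps. Qed.

Lemma HF_basis gs m : exists qs, [/\ size qs = HF gs m, forms m qs, lin_indep_mod gs qs &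
  forall p, p \is m.-homog -> spanned gs qs p].
Proof.
have [N bN] := HF_bounded gs m.
have [|qs [sqs hqs ind]] := natsup_mem (r := 0%N) bN; first by exists [::].
exists qs; split=> // p hp.
case: (ClassicalEpsilon.excluded_middle_informative (spanned gs qs p)) => // nsp.
have fp : forms m (p :: qs) by rewrite /forms /= hp.
by have := leq_HF fp (lin_indep_cons ind nsp); rewrite /HF -sqs ltnn.
Qed.

Lemma HF_le gs m N :
  (forall ps, forms m ps -> lin_indep_mod gs ps -> (size ps <= N)%N) -> (HF gs m <= N)%N.
Proof. by move=> h; apply: natsup_le => _ [ps [<- hps ind]]; apply: h. Qed.

Lemma HF_mono gs gs' m : (forall p, in_ideal gs p -> in_ideal gs' p) -> (HF gs' m <= HF gs m)%N.
Proof. by move=> sub; apply: HF_le => ps hps /(lin_indep_sub sub); apply: leq_HF. Qed.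

Lemma HF_basis_size gs m qs : forms m qs -> lin_indep_mod gs qs ->
  (forall p, p \is m.-homog -> spanned gs qs p) -> HF gs m = size qs.
Proof.
move=> hqs ind sp; apply/eqP; rewrite eqn_leq leq_HF // andbT.
by apply: HF_le => ps hps /indep_size_le; apply=> p /(allP hps); apply: sp.
Qed.

(* The exact sequence 0 -> S/I(-d) -> S/I -> S/(I, g) -> 0. *)
Lemma HF_rcons gs g d m : graded gs -> g \is d.-homog ->
  (forall h, in_ideal gs (h * g) -> in_ideal gs h) ->
  HF gs m = (HF (rcons gs g) m + (if (d <= m)%N then HF gs (m - d) else 0))%N.
Proof.
move=> hgs hg reg; have [qs [<- hqs indq spq]] := HF_basis (rcons gs g) m.
(* [bs] is a basis modulo [gs] in degree [m - d], empty if that is negative. The multiples of [bs]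
   by [g], appended to [qs], will be a basis in degree [m]. *)
have [bs [sb hb indb spb]] : exists bs, [/\ size bs = (if (d <= m)%N then HF gs (m - d) else 0)%N,
    forms m (map ( *%R^~ g) bs), lin_indep_mod gs bs &
    forall a, zhomog (m%:Z - d%:Z) a -> spanned gs bs a].
  case: leqP => [dm|md]; last first.
    exists [::]; split=> // a /zhomog_lt0 ->; last by lia.
    by exists [::] => //; rewrite /lcomb big_ord0 subrr; apply: in_ideal0.
  have [bs [sb hb indb spb]] := HF_basis gs (m - d); exists bs; split=> // [|a].
    apply/allP => _ /mapP [b /(allP hb) bh ->].
    by rewrite -(subnK dm); apply: dhomogM.
  by rewrite subzn // => /zhomogP /spb.
rewrite -sb -(size_map ( *%R^~ g)) -size_cat; apply: HF_basis_size.
- by rewrite /forms all_cat; apply/andP.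
- apply: lin_indep_cat => [c|c1 c2 s1 s2].
    rewrite size_map => sc.
    have := lcomb_map_mul c bs g; rewrite /lcomb size_map => -> /reg; exact: indb.
  rewrite lcomb_map_mul => Ic; apply: (@eq_from_nth _ 0); rewrite ?size_nseq // => i.
  rewrite s1 => ilt; rewrite nth_nseq ilt; apply: indq ilt => //.
  apply/in_ideal_rcons; exists (- lcomb c2 bs).
  by rewrite mulNr opprK.
move=> p hp; have [c sc Ic] := spq p hp.
have hpc : zhomog m (p - lcomb c qs).
  by apply/zhomogP; apply: rpredB => //; apply: forms_lcomb.
have [a ha Ia] := in_ideal_rcons_homog hgs hg hpc Ic.
have [e se Ie] := spb a ha; exists (c ++ e); first by rewrite !size_cat size_map sc se.
rewrite lcomb_cat // lcomb_map_mul opprD addrA -[p - _](subrK (a * g)) -addrA -mulrBl.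
by apply: in_idealD => //; rewrite mulrC; apply: in_idealM.
Qed.

(** By [HF_rcons] each further regular element changes the Hilbert function in a way that depends
    only on its degree. *)
Lemma HF_regular_eq (fs gs : seq S) (d : nat -> nat) i m :
  (i <= size fs)%N -> size fs = size gs -> regular_seq fs -> regular_seq gs ->
  (forall j, (j < size fs)%N -> fs`_j \is (d j).-homog) ->
  (forall j, (j < size gs)%N -> gs`_j \is (d j).-homog) ->
  HF (take i fs) m = HF (take i gs) m.
Proof.
move=> ifs sfg rf rg hf hg; elim: i m ifs => [|i IH] m ilt; first by rewrite !take0.
have := @HF_rcons (take i fs) fs`_i (d i) m (@graded_fs _ _ _ _ hf i) (hf i ilt) (proj2 rf i ilt).
have iltg : (i < size gs)%N by rewrite -sfg.
have := @HF_rcons (take i gs) gs`_i (d i) m (@graded_fs _ _ _ _ hg i) (hg i iltg) (proj2 rg i iltg).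
rewrite -!take_nth // !IH ?(ltnW ilt) //.
by move=> -> /addIn.
Qed.

(* The forms [X_j G] span a space of dimension [n - r] modulo [gs], where [r]
   is the dimension of the space of linear forms annihilating [G]. *)
Lemma HF_add_form gs (E : nat) G : G \is E.-homog ->
  exists r (B : 'M[k]_n), [/\ (r <= n)%N, B \in unitmx,
    forall i : 'I_n, (i < r)%N -> in_ideal gs (linform (row i B) * G) &
    (HF (rcons gs G) E.+1 + (n - r) <= HF gs E.+1)%N].
Proof.
move=> hG; have [qs [<- hqs indq spq]] := HF_basis gs E.+1.
have [|M IM] := @coord_matrix k n gs n (fun j => 'X_j * G) qs.
  move=> j; apply: spq; rewrite -add1n; apply: dhomogM => //.
  by rewrite dhomogX; apply/eqP/mdeg1.
have linM v : in_ideal gs (linform v * G - vcomb (v *m M) (seq_fun (ps := qs))).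
  have -> : linform v * G = vcomb v (fun j => 'X_j * G).
    by rewrite mulr_suml; apply: eq_bigr => j _; rewrite scalerAl.
  exact: vcombM.
(* The kernel of [M] consists of the linear forms annihilating [G] modulo [gs]; the first rows of
   its [row_ebase] are a basis of it, completed to an invertible matrix. *)
exists (\rank (kermx M)), (row_ebase (kermx M)); split.
- exact: rank_leq_row.
- exact: row_ebase_unit.
- move=> i ir; rewrite -[_ * G]subr0.
  suff v0 : row i (row_ebase (kermx M)) *m M = 0.
    by have := linM (row i (row_ebase (kermx M))); rewrite v0 vcomb0.
  have -> : row i (row_ebase (kermx M)) =
      row i (pid_mx (\rank (kermx M)) *m row_ebase (kermx M)).
    rewrite row_mul [LHS]rowE; congr (_ *m _).
    by apply/rowP => j; rewrite !mxE ir andbT eq_sym.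
  rewrite -row_mul -mulmxA.
  have /(congr1 (mulmx (invmx (col_ebase (kermx M))))) := mulmx_ker M.
  rewrite -{2}(mulmx_ebase (kermx M)) mulmx0 -!mulmxA mulKmx ?col_ebase_unit // => ->.
  by rewrite row0.
rewrite mxrank_ker subKn ?rank_leq_row //.
have [ps [<- hps indp _]] := HF_basis (rcons gs G) E.+1.
have [|P IP] := @coord_matrix k n gs _ (seq_fun (ps := ps)) qs.
  by move=> i; apply/spq/(allP hps)/mem_nth.
have freeP : row_free P.
  by apply: indep_coord_free IP; apply: lin_indep_sub indp => p; apply: in_ideal_rconsl.
(* A common vector gives a combination of [ps] congruent to a multiple of [G], hence zero modulo
   [rcons gs G], where [ps] is independent. So the ranks of [P] and [M] add up inside a space of
   dimension [size qs]. *)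
have cap0 : (P :&: M)%MS = 0.
  apply/eqP/rowV0P => v; rewrite sub_capmx => /andP [/submxP [u vu] /submxP [w vw]].
  suff u0 : u = 0 by rewrite vu u0 mul0mx.
  move/lin_indepP: indp; apply; apply/in_ideal_rcons; exists (linform w).
  have := in_idealB (vcombM u IP) (linM w); rewrite -vu -vw.
  by rewrite opprB addrA subrK.
have := mxrank_sum_cap P M; rewrite cap0 mxrank0 addn0 (eqP freeP) => <-.
exact: rank_leq_col.
Qed.

End HilbertFunction.

(** * Standard monomials and the lex-largest one *)

Section OrdinalExtension.
Variable n : nat.

(** Extension by 0 to all naturals: the degree bounds sum over initial segments of a family indexed
    by [nat]. *)
Definition ord_ext (F : 'I_n -> nat) (i : nat) : nat :=
  if insub i is Some j then F j else 0%N.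

Lemma ord_extE F (i : 'I_n) : ord_ext F i = F i.
Proof. by rewrite /ord_ext valK. Qed.

Lemma sum_ord_ext F j : (j <= n)%N ->
  (\sum_(i < j) ord_ext F i = \sum_(i < n | (i < j)%N) F i)%N.
Proof.
by move=> jn; rewrite (big_ord_widen _ (ord_ext F) jn); apply: eq_bigr => i _; rewrite ord_extE.
Qed.

Lemma sum_ord_ext_full F : (\sum_(i < n) ord_ext F i = \sum_(i < n) F i)%N.
Proof. by apply: eq_bigr => i _; rewrite ord_extE. Qed.

End OrdinalExtension.

Section StandardMonomials.
Variables (k : fieldType) (n : nat) (d : 'I_n -> nat).
Implicit Types (u v w : 'X_{1..n}) (E m : nat).

(** The monomials outside the ideal of pure powers; the sum of the [d i] only provides one finite
    range large enough for all exponents. *)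
Definition std_monomials : seq 'X_{1..n} :=
  [seq [multinom (g i : nat) | i < n] |
    g : {ffun 'I_n -> 'I_(\sum_i d i).+1} in
      family (fun i => [pred j : 'I_(\sum_i d i).+1 | (j < d i)%N])].

Lemma mem_std_monomials w : (w \in std_monomials) = [forall i, (w i < d i)%N].
Proof.
apply/imageP/forallP => [[g /familyP gd -> i]|wd]; first by rewrite mnmE; apply: gd.
exists [ffun i => inord (w i)].
  apply/familyP => i; rewrite ffunE inE inordK // ltnS (leq_trans (ltnW (wd i))) //.
  by rewrite (bigD1 i) //= leq_addr.
apply/mnmP => i; rewrite mnmE ffunE inordK // ltnS (leq_trans (ltnW (wd i))) //.
by rewrite (bigD1 i) //= leq_addr.
Qed.

Lemma uniq_std_monomials : uniq std_monomials.
Proof.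
rewrite map_inj_uniq ?enum_uniq // => g h /mnmP gh; apply/ffunP => i.
by apply: val_inj; have := gh i; rewrite !mnmE.
Qed.

Lemma size_std_monomials : size std_monomials = (\prod_i d i)%N.
Proof.
rewrite size_map -cardE card_family foldrE big_map big_enum /=.
apply: eq_bigr => i _; have le : (d i <= (\sum_i d i).+1)%N.
  by apply: leqW; rewrite (bigD1 i) //= leq_addr.
by rewrite -sum1_card -(big_ord_widen _ (fun=> 1%N) le) sum1_card card_ord.
Qed.

Lemma in_pure_powersX w : in_ideal (pure_powers k d) 'X_[w] <-> w \notin std_monomials.
Proof.
rewrite pure_powersE in_monomial_idealX has_map mem_std_monomials negb_forall.
split=> [/hasP [i _]|/existsP [i]].
  by rewrite /= pure_power_lem leqNgt => ?; apply/existsP; exists i.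
by rewrite -leqNgt => ?; apply/hasP; exists i; rewrite ?mem_enum //= pure_power_lem.
Qed.

Lemma std_mdeg w : w \in std_monomials -> (mdeg w <= sigma d)%N.
Proof.
rewrite mem_std_monomials mdegE => /forallP wd; apply: leq_sum => i _.
by have := wd i; lia.
Qed.

Definition std_deg m := [seq w <- std_monomials | mdeg w == m].

Lemma HF_pure_le m : (HF (pure_powers k d) m <= size (std_deg m))%N.
Proof.
apply: HF_le => ps hps /indep_size_le le.
rewrite -(size_map (fun w => 'X_[w] : {mpoly k[n]}) (std_deg m)); apply: le.
move=> p /(allP hps) /dhomogP hp; apply: spanned_monomials.
  exact/filter_uniq/uniq_std_monomials.
move=> w; rewrite -mcoeff_msupp => /hp wm; rewrite mem_filter in_pure_powersX.
by case: (w \in std_monomials); [left; rewrite andbT; apply/eqP | right].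
Qed.

Lemma HF_pure_eq0 m : (sigma d < m)%N -> HF (pure_powers k d) m = 0%N.
Proof.
move=> lt; apply/eqP; rewrite -leqn0 (leq_trans (HF_pure_le m)) // leqn0 size_eq0.
rewrite -[_ == _]negbK -has_filter; apply/hasPn => w /std_mdeg; lia.
Qed.

Lemma sum_HF_pure : (\sum_(m < (sigma d).+1) HF (pure_powers k d) m <= \prod_i d i)%N.
Proof.
rewrite -size_std_monomials; apply: (@leq_trans (\sum_(m < (sigma d).+1) size (std_deg m))%N).
  by apply: leq_sum => m _; apply: HF_pure_le.
under eq_bigr => m _ do rewrite size_filter -sum1_count big_mkcond /=.
rewrite exchange_big /= -sum1_size; apply: leq_sum => w _.
rewrite -big_mkcond /= sum1_card -[leqRHS](card1 (inord (mdeg w) : 'I_(sigma d).+1)).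
apply/subset_leq_card/subsetP => m; rewrite !inE => /eqP ->.
by rewrite inord_val.
Qed.

Lemma indep_monomials (us vs : seq 'X_{1..n}) : uniq vs ->
  (forall v, v \in vs -> ~~ has (fun u => (u <= v)%MM) us) ->
  lin_indep_mod (monomials k us) (monomials k vs).
Proof.
move=> uvs nd c sc /in_monomial_ideal Ic i; rewrite size_map => ilt.
have := Ic (nth 0%MM vs i); rewrite (negPf (nd _ _)) ?mem_nth //.
have -> : (\sum_(j < size (monomials k vs)) c`_j *: (monomials k vs)`_j)@_(nth 0%MM vs i) = c`_i.
  rewrite raddf_sum size_map (bigD1 (Ordinal ilt)) //= (nth_map 0%MM) //.
  rewrite mcoeffZ mcoeffX eqxx mulr1 big1 ?addr0 // => j.
  move=> /negPf ji; have {}ji : (j == i :> nat) = false := ji.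
  by rewrite (nth_map 0%MM) // mcoeffZ mcoeffX nth_uniq // ji mulr0.
by have [//|_ /(_ isT)] := eqVneq c`_i 0.
Qed.

(** The standard monomials of degree [E.+1] not divisible by [u] are independent modulo [Llex]; each
    of the others is [u] times a variable whose exponent in [u] can still grow. *)
Lemma HF_Llex_ge E (u := U_mon k d E) : mdeg u = E ->
  (HF (pure_powers k d) E.+1 <= HF (Llex k d E) E.+1 + #|[set j | (u j).+1 < d j]|)%N.
Proof.
move=> uE; apply: leq_trans (HF_pure_le _) _.
rewrite -(count_predC (fun w => u <= w)%MM (std_deg E.+1)) addnC; apply: leq_add.
  rewrite -size_filter -(size_map (fun w => 'X_[w] : {mpoly k[n]})).
  have LE : Llex k d E = monomials k (rcons [seq (U_(i) *+ d i)%MM | i <- enum 'I_n] u).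
    by rewrite /Llex pure_powersE /monomials map_rcons.
  apply: leq_HF.
    apply/allP => _ /mapP [w + ->]; rewrite !mem_filter => /and3P [_ wE _].
    by rewrite dhomogX.
  rewrite LE; apply: indep_monomials; first by rewrite !filter_uniq ?uniq_std_monomials.
  move=> w; rewrite !mem_filter has_rcons => /and3P [/= /negPf -> _ ws] /=.
  apply/negP => /(in_monomial_idealX k); rewrite -/(monomials _ _) -pure_powersE.
  by move/in_pure_powersX; rewrite ws.
rewrite -size_filter cardE -(size_map (fun j => (u + U_(j))%MM)).
apply: uniq_leq_size; first by rewrite !filter_uniq ?uniq_std_monomials.
move=> w; rewrite !mem_filter mem_std_monomials => /and3P [uw /eqP wE /forallP wd].
have /mdeg1P [j /eqP wuj] : mdeg (w - u)%MM == 1%N.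
  have := congr1 (@mdeg n) (submK uw); rewrite mdegD uE wE; lia.
apply/mapP; exists j; last by rewrite -wuj addmC submK.
have := wd j; rewrite -(submK uw) wuj mem_enum inE mnmDE mnm1E eqxx; lia.
Qed.

Hypothesis d_gt0 : forall i, (0 < d i)%N.

(* The lex-largest standard monomial of degree [E] is found greedily. *)
Definition greedy E : 'X_{1..n} :=
  [multinom minn (d i - 1) (E - \sum_(j < i) ord_ext (fun l => d l - 1) j)%N | i < n].

Lemma greedy_sum E i : (i <= n)%N ->
  (\sum_(j < i) ord_ext (greedy E) j = minn E (\sum_(j < i) ord_ext (fun l => d l - 1) j))%N.
Proof.
elim: i => [|i IH] ilt; first by rewrite !big_ord0 minn0.
rewrite !big_ord_recr /= IH ?(ltnW ilt) //.
rewrite (ord_extE _ (Ordinal ilt)) (ord_extE (fun l => d l - 1)%N (Ordinal ilt)) mnmE /=.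
lia.
Qed.

Lemma greedy_spec E : (E <= sigma d)%N -> U_spec k d E (greedy E).
Proof.
move=> Es; split.
- rewrite mdegE -sum_ord_ext_full greedy_sum // sum_ord_ext_full.
  exact/minn_idPl.
- move/in_pure_powersX; rewrite mem_std_monomials => /forallP; apply=> i.
  by rewrite mnmE; have := d_gt0 i; lia.
move=> v vE nv; have vd i : (v i < d i)%N.
  have : v \in std_monomials by apply/negPn/negP => /in_pure_powersX.
  by rewrite mem_std_monomials => /forallP.
have [->|neq] := eqVneq v (greedy E); [by left | right].
have [j0 j0P] : exists j : 'I_n, v j != greedy E j.
  apply/existsP; apply: contraNT neq => /existsPn h; apply/eqP/mnmP => i.
  by apply/eqP/negPn.
have [i iP imin] := @arg_minnP _ j0 (fun j => v j != greedy E j) (@nat_of_ord n) j0P.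
have eqlt (j : 'I_n) : (j < i)%N -> v j = greedy E j.
  by rewrite ltnNge => ji; apply/eqP; apply: contraNT ji; apply: imin.
apply/existsP; exists i; apply/andP; split.
  by apply/forallP => j; apply/implyP => /eqlt ->.
(* If [v] were larger at the first difference [i], the greedy exponent there would be below
   [d i - 1], so [greedy E] would have used up all of [E] by index [i] and the partial sum of [v]
   would exceed [E]. *)
rewrite ltn_neqAle iP leqNgt; apply/negP => lt.
have := greedy_sum E (ltn_ord i); have := lt; have := vd i.
rewrite {1}mnmE => vi gi.
have -> : (\sum_(j < i.+1) ord_ext (fun l => d l - 1) j =
    \sum_(j < i) ord_ext (fun l => d l - 1) j + (d i - 1))%N.
  by rewrite big_ord_recr /= ord_extE.
have : (\sum_(j < i.+1) ord_ext (greedy E) j < \sum_(j < i.+1) ord_ext v j)%N.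
  rewrite !big_ord_recr /= !ord_extE -addnS leq_add // leq_sum // => j _.
  have jn : (j < n)%N by apply: ltn_trans (ltn_ord j) (ltn_ord i).
  by rewrite (ord_extE _ (Ordinal jn)) (ord_extE v (Ordinal jn)) eqlt /=.
have : (\sum_(j < i.+1) ord_ext v j <= E)%N.
  rewrite sum_ord_ext // -vE mdegE [leqRHS](bigID (fun j : 'I_n => j < i.+1)%N) /=.
  exact: leq_addr.
lia.
Qed.

Lemma U_mon_spec E : (E <= sigma d)%N -> U_spec k d E (U_mon k d E).
Proof.
move=> Es; apply: ClassicalEpsilon.epsilon_spec.
by exists (greedy E); apply: greedy_spec.
Qed.

(* [U] is x_1^(d_1-1) .. x_(j-1)^(d_(j-1)-1) x_j^b with b < d_j - 1. *)
Lemma U_spec_deg E u : U_spec k d E u -> (E < sigma d)%N ->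
  let T := #|[set j | d j <= (u j).+1]|%N in
  (T < n)%N -> (E + T.+1 < \sum_(i < T.+1) ord_ext d i)%N.
Proof.
move=> [uE nu umax] Es T Tn.
have ud i : (u i < d i)%N.
  have : u \in std_monomials by apply/negPn/negP => /in_pure_powersX.
  by rewrite mem_std_monomials => /forallP.
have [j1 j1P] : exists j : 'I_n, ((u j).+1 < d j)%N.
  apply/existsP; apply: contraLR Es => /existsPn h; rewrite -leqNgt -uE mdegE.
  by apply: leq_sum => i _; have := h i; lia.
(* [j] is the first variable whose exponent is not maximal; it exists because [E < sigma d]. *)
have [j jP jmin] := @arg_minnP _ j1 (fun j => (u j).+1 < d j)%N (@nat_of_ord n) j1P.
have before (i : 'I_n) : (i < j)%N -> (d i <= (u i).+1)%N.
  by rewrite ltnNge => ij; rewrite leqNgt; apply: contra ij; apply: jmin.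
(* Otherwise moving one unit of exponent from [i] to [j] would give a lex-larger standard monomial
   [v] of the same degree. *)
have after (i : 'I_n) : (j < i)%N -> u i = 0%N.
  move=> ji; apply/eqP; rewrite -leqn0 leqNgt; apply/negP => ui.
  pose v := (u + U_(j) - U_(i))%MM.
  have leU : (U_(i) <= u + U_(j))%MM.
    apply/mnm_lepP => l; rewrite mnmDE !mnm1E.
    by have [<-|] := eqVneq i l; rewrite //= (leq_trans ui) // leq_addr.
  have ij : i != j by apply: contraTneq ji => ->; rewrite ltnn.
  have vE l : v l = (u l + (j == l) - (i == l))%N by rewrite mnmBE mnmDE !mnm1E.
  have := umax v; case.
  - by have := congr1 (@mdeg n) (submK leU); rewrite -/v !mdegD !mdeg1 uE; lia.
  - move/in_pure_powersX; rewrite mem_std_monomials => /forallP; apply=> l.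
    by rewrite vE; have := ud l; have [<-|] := eqVneq j l; lia.
  - move/mnmP/(_ j); rewrite vE eqxx (negPf ij); lia.
  case/existsP => l /andP [/forallP eql]; rewrite vE => lt.
  have li : i = l by apply/eqP; move: lt; case: (i == l) => //; lia.
  have := eql j; rewrite -li ji vE eqxx (negPf ij) => /eqP; lia.
(* All variables before [j] have maximal exponent and are counted by [T]. *)
have jT : (j <= T)%N.
  rewrite -[nat_of_ord j]card_ord /T.
  have inj : injective (widen_ord (ltnW (ltn_ord j))) by move=> x y /(congr1 val) /= /val_inj.
  rewrite -(card_imset _ inj); apply/subset_leq_card/subsetP => _ /imsetP [x _ ->].
  by rewrite inE before //=.
have sumE : (\sum_(i < T.+1) ord_ext d i = \sum_(i < T.+1) ord_ext (fun l => d l - 1) i + T.+1)%N.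
  rewrite -[X in (_ + X)%N]card_ord -sum1_card -big_split /=; apply: eq_bigr => i _.
  have iN : (i < n)%N by apply: leq_trans (ltn_ord i) Tn.
  rewrite (ord_extE _ (Ordinal iN)) (ord_extE (fun l => d l - 1)%N (Ordinal iN)).
  by rewrite subnK.
(* Thus [u] is supported on the first [T.+1] variables, with exponents at most [d i - 1] and
   strictly smaller at [j]. *)
rewrite sumE ltn_add2r sum_ord_ext // -uE mdegE.
rewrite (bigID (fun i : 'I_n => i < T.+1)%N) /= [X in (_ + X)%N]big1 ?addn0; last first.
  by move=> i; rewrite -leqNgt => Ti; apply: after; apply: leq_ltn_trans jT Ti.
rewrite (bigD1 j) //= [ltnRHS](bigD1 j) //= -addSn leq_add //; first by lia.
by apply: leq_sum => i _; have := ud i; lia.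
Qed.

End StandardMonomials.

(** * Almost complete intersections *)

Section Multiplicity.
Variables (k : fieldType) (n : nat).
Local Notation S := {mpoly k[n]}.
Implicit Types (gs qs : seq S) (p : S).

Lemma spanned_nil gs p : spanned gs [::] p <-> in_ideal gs p.
Proof.
split=> [[c _]|Ip]; first by rewrite /lcomb big_ord0 subr0.
by exists [::]; rewrite // /lcomb big_ord0 subr0.
Qed.

Lemma spanned_cat gs qs1 qs2 p1 p2 : spanned gs qs1 p1 -> spanned gs qs2 p2 ->
  spanned gs (qs1 ++ qs2) (p1 + p2).
Proof.
move=> [c1 s1 I1] [c2 s2 I2]; exists (c1 ++ c2); first by rewrite !size_cat s1 s2.
by rewrite lcomb_cat // opprD addrACA; apply: in_idealD.
Qed.

(** A finite independent family involves finitely many degrees, so it is spanned by the union of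
    bases of those graded pieces; the pieces from [N] on are zero. *)
Lemma mult_artinian_le gs N : (forall m, (N <= m)%N -> HF gs m = 0%N) ->
  (mult_artinian gs <= \sum_(m < N) HF gs m)%N.
Proof.
move=> HF0; apply: natsup_le => _ [ps [<- ind]].
have basis M : exists qs, size qs = (\sum_(m < M) HF gs m)%N /\
    forall p, (msize p <= M)%N -> spanned gs qs p.
  suff [qs [sqs qsP]] : exists qs, size qs = (\sum_(m < M) HF gs m)%N /\
      forall p, spanned gs qs (\sum_(m < M) pihomog mdeg m p).
    by exists qs; split=> // p pM; rewrite [p](pihomog_partitionE pM).
  elim: M => [|M [qs [sqs qsP]]].
    exists [::]; rewrite big_ord0; split=> // p; rewrite big_ord0.
    by apply/spanned_nil/in_ideal0.
  have [bs [sbs _ _ bsP]] := HF_basis gs M.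
  exists (qs ++ bs); rewrite size_cat big_ord_recr /= sqs sbs; split=> // p.
  by rewrite big_ord_recr; apply/spanned_cat/bsP/pihomogP.
have [qs [sqs qsP]] := basis (maxn N (\max_(p <- ps) msize p)).
apply: (@leq_trans (size qs)).
  apply: indep_size_le ind _ => p pps; apply: qsP.
  by rewrite leq_max (leq_bigmax_seq _ pps) ?orbT.
rewrite sqs -(subnKC (leq_maxl N (\max_(p <- ps) msize p))) big_split_ord /=.
by rewrite [X in (_ + X)%N]big1 ?addn0 // => i _; rewrite HF0 // leq_addr.
Qed.

End Multiplicity.

(** * Comparison of an almost complete intersection with the lex ideal *)

Section AlmostCompleteIntersection.
Variables (k : fieldType) (n : nat) (d : 'I_n -> nat) (f : 'I_n -> {mpoly k[n]}).
Local Notation S := {mpoly k[n]}.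
Local Notation fs := [seq f i | i <- enum 'I_n].
Hypothesis d_mono : forall i j : 'I_n, (i <= j)%N -> (d i <= d j)%N.
Hypothesis hom_f : forall i : 'I_n, f i \is (d i).-homog.
Hypothesis reg_f : regular_seq fs.

Lemma size_fs : size fs = n.
Proof. by rewrite size_map size_enum_ord. Qed.

Lemma nth_fs (i : 'I_n) : fs`_i = f i.
Proof. by rewrite (nth_map i) ?size_enum_ord // nth_ord_enum. Qed.

Lemma hom_fs i : (i < size fs)%N -> fs`_i \is (ord_ext d i).-homog.
Proof.
rewrite size_fs => ilt; rewrite -[i]/(nat_of_ord (Ordinal ilt)).
by rewrite nth_fs ord_extE.
Qed.

Lemma mono_ext i j : (i <= j < size fs)%N -> (ord_ext d i <= ord_ext d j)%N.
Proof.
rewrite size_fs => /andP [ij jlt]; have ilt := leq_ltn_trans ij jlt.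
by rewrite (ord_extE _ (Ordinal ilt)) (ord_extE _ (Ordinal jlt)) d_mono.
Qed.

(** A form of degree 0 is a constant. If zero, regularity puts 1 into the ideal of the earlier
    forms; if nonzero, it generates the unit ideal itself. *)
Lemma regular_degree_gt0 i : (0 < d i)%N.
Proof.
rewrite lt0n; apply/negP => /eqP di0; case: (reg_f) => n1 reg.
have ilt : (i < size fs)%N by rewrite size_fs.
have take_sub p : in_ideal (take i fs) p -> in_ideal fs p.
  by apply: in_ideal_subset => g /mem_take; apply: in_ideal_mem.
have fiE : f i = ((f i)@_0%MM)%:MP.
  apply/mpolyP => w; rewrite mcoeffC; have [->|w0] := eqVneq w 0%MM; first by rewrite mulr1.
  by rewrite mulr0 (dhomog_nemf_coeff (hom_f i)) // di0 /= mdeg_eq0.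
have [c0|c0] := eqVneq (f i)@_0%MM 0.
  apply/n1/take_sub/(reg _ ilt); rewrite nth_fs fiE c0 mpolyC0 mulr0.
  exact: in_ideal0.
apply: n1; have := in_idealM (((f i)@_0%MM)^-1)%:MP (in_ideal_mem (map_f f (mem_enum _ i))).
by rewrite {2}fiE -mpolyCM mulVf.
Qed.

Lemma HF_complete_intersection m : HF fs m = HF (pure_powers k d) m.
Proof.
have sp : size (pure_powers k d) = n by rewrite size_map size_enum_ord.
rewrite -[fs]take_size -[pure_powers k d]take_size sp size_fs.
apply: (@HF_regular_eq _ _ _ _ (ord_ext d)) => //.
- by rewrite size_fs.
- by rewrite size_fs sp.
- exact/regular_pure_powers/regular_degree_gt0.
- exact: hom_fs.
rewrite sp => j jlt; rewrite -[j]/(nat_of_ord (Ordinal jlt)) (nth_map (Ordinal jlt)).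
  by rewrite nth_ord_enum ord_extE mpolyXn dhomogX; apply/eqP; rewrite /= mdegMn mdeg1 mul1n.
by rewrite size_enum_ord.
Qed.

(* The socle of S/(f_1..f_n) lives in degree [sigma d]. *)
Lemma not_in_ideal_mulX E G : G \is E.-homog -> ~ in_ideal fs G -> (E < sigma d)%N ->
  exists i, ~ in_ideal fs ('X_i * G).
Proof.
move=> hG nG Es; case: (ClassicalEpsilon.excluded_middle_informative
  (exists i, ~ in_ideal fs ('X_i * G))) => // nex; exfalso.
have XG i : in_ideal fs ('X_i * G).
  case: (ClassicalEpsilon.excluded_middle_informative (in_ideal fs ('X_i * G))) => // ?.
  by case: nex; exists i.
have := annihilator_rank (unitmx1 k n) (leqnn n) hom_fs reg_f mono_ext hG _ nG.
rewrite sum_ord_ext_full => le; move: Es; rewrite ltnNge => /negP; apply.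
rewrite -(leq_add2r n); apply: leq_trans (le _).
  rewrite /sigma -[X in (_ + X <= _)%N]card_ord -sum1_card -big_split /= leq_sum // => i _.
  by rewrite subnK // regular_degree_gt0.
by move=> i _; rewrite -lin_substX lin_subst1.
Qed.

(** Starting from [G], multiply by one suitable variable at a time; below degree [sigma d] some
    variable always keeps the product outside the ideal. *)
Lemma exists_form_of_degree D E G : G \is D.-homog -> ~ in_ideal fs G ->
  (D <= E <= sigma d)%N ->
  exists H, [/\ H \is E.-homog, ~ in_ideal fs H & in_ideal (rcons fs G) H].
Proof.
move=> hG nG; elim: E => [|E IH] /andP [].
  by rewrite leqn0 => /eqP D0 _; rewrite D0 in hG; exists G; split=> //; apply: in_ideal_rconsr.
rewrite leq_eqVlt => /predU1P [<- _|DE Es].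
  by exists G; split=> //; apply: in_ideal_rconsr.
have [|H [hH nH IH']] := IH; first by rewrite -ltnS DE ltnW.
have [i ni] := not_in_ideal_mulX hH nH Es; exists ('X_i * H); split=> //.
  by rewrite -add1n; apply: dhomogM => //; rewrite dhomogX; apply/eqP/mdeg1.
exact: in_idealM.
Qed.

Lemma HF_add_form_le_Llex E G : G \is E.-homog -> ~ in_ideal fs G -> (E < sigma d)%N ->
  (HF (rcons fs G) E.+1 <= HF (Llex k d E) E.+1)%N.
Proof.
move=> hG nG Es; have U_E := U_mon_spec k regular_degree_gt0 (ltnW Es).
have [uE _ _] := U_E; have := HF_Llex_ge uE.
have [r [B [rn uB annB le]]] := HF_add_form fs hG.
have := U_spec_deg regular_degree_gt0 U_E Es.
set T := #|[set j | _]| => /= degT; rewrite -HF_complete_intersection => ge.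
(* Otherwise [T.+1] independent linear forms annihilate [G], and [annihilator_rank] contradicts
   [degT]. *)
have rT : (r <= T)%N.
  rewrite leqNgt; apply/negP => Tr; have Tn := leq_trans Tr rn.
  have := degT Tn; rewrite ltnNge => /negP; apply.
  apply: (annihilator_rank uB Tn hom_fs reg_f mono_ext hG _ nG) => i iT.
  by apply: annB; apply: leq_trans Tr.
(* Adding [G] lowers the Hilbert function by at least [n - r], adding the lex monomial by at most
   [n - T]. *)
have cardT : (T + #|[set j | ((U_mon k d E) j).+1 < d j]|)%N = n.
  rewrite -[RHS]card_ord -(cardC (mem [set j | (d j <= (U_mon k d E j).+1)%N])).
  by congr (_ + _)%N; apply: eq_card => j; rewrite !inE -ltnNge.
move: le ge cardT; set c := #|_|.
move: c (HF _ _) (HF (rcons _ _) _) (HF (Llex _ _ _) _); clearbody T; lia.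
Qed.

End AlmostCompleteIntersection.

Theorem theorem3p2 (k : fieldType) (n : nat) (d : 'I_n -> nat) (D : nat)
    (f : 'I_n -> {mpoly k[n]}) (G : {mpoly k[n]}) :
  (0 < n)%N ->
  (forall i j : 'I_n, (i <= j)%N -> (d i <= d j)%N) ->
  (forall i : 'I_n, f i \is (d i).-homog) ->
  regular_seq [seq f i | i <- enum 'I_n] ->
  G \is D.-homog ->
  ~ in_ideal [seq f i | i <- enum 'I_n] G ->
  artinian (rcons [seq f i | i <- enum 'I_n] G) ->
  (D <= sigma d)%N ->
  (forall m : nat, (D < m <= sigma d)%N ->
     (HF (rcons [seq f i | i <- enum 'I_n] G) m)%:Z
       <= (HF (@pure_powers k n d) m)%:Z - phi k d m) /\
  (mult_artinian (rcons [seq f i | i <- enum 'I_n] G))%:Z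
    <= (\prod_(i < n) d i)%N%:Z - \sum_(D.+1 <= m < (sigma d).+1) phi k d m - 1.
Proof.
move=> _ d_mono hom_f reg_f hG nG _ Ds.
set fs := [seq f i | i <- enum 'I_n] in reg_f nG *.
have HFci := HF_complete_intersection hom_f reg_f; rewrite -/fs in HFci.
have HFle m : (HF (rcons fs G) m <= HF (pure_powers k d) m)%N.
  by rewrite -HFci; apply: HF_mono => p; apply: in_ideal_rconsl.
have part1 m : (D < m <= sigma d)%N ->
    (HF (rcons fs G) m)%:Z <= (HF (pure_powers k d) m)%:Z - phi k d m.
  (* The default value 0 of [phi] occurs here only for [m = 1], where [HFle] suffices. *)
  move=> /andP [Dm ms]; rewrite /phi; case: ifP => [/andP [m2 _]|_]; last first.
    by rewrite subr0 lez_nat.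
  rewrite subKr lez_nat.
  case: m m2 Dm ms => // E _ DE Es.
  (* Replacing [G] by a multiple [H] modulo [fs] of degree exactly [m - 1] shrinks the ideal, so it
     can only raise the Hilbert function. *)
  have [|H [hH nH HI]] := exists_form_of_degree d_mono hom_f reg_f hG nG (E := E).
    by rewrite -ltnS DE ltnW.
  apply: leq_trans (HF_add_form_le_Llex d_mono hom_f reg_f hH nH Es).
  apply: HF_mono => p; apply: in_ideal_subset => g.
  rewrite mem_rcons inE => /predU1P [->//|gfs].
  by apply/in_ideal_rconsl/in_ideal_mem.
split=> //.
(* A basis in degree [D] modulo [rcons fs G] stays independent modulo [fs] after adjoining [G]. This
   strict inequality yields the final -1 of the multiplicity bound. *)
have HFD : (HF (rcons fs G) D < HF (pure_powers k d) D)%N.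
  rewrite -HFci; have [ps [<- hps ind _]] := HF_basis (rcons fs G) D.
  have hGps : forms D (G :: ps) by rewrite /forms /= hG.
  apply: (leq_HF hGps); apply: lin_indep_cons.
    by apply: lin_indep_sub ind => p; apply: in_ideal_rconsl.
  move=> [c sc Ic]; apply: nG.
  suff l0 : lcomb c ps = 0 by rewrite l0 subr0 in Ic.
  apply: big1 => i _; rewrite (ind c sc _ i) ?scale0r //.
  rewrite -[X in in_ideal _ X](subKr G); apply: in_idealB; first exact: in_ideal_rconsr.
  exact: in_ideal_rconsl.
have HF0 m : ((sigma d).+1 <= m)%N -> HF (rcons fs G) m = 0%N.
  by move=> sm; apply/eqP; rewrite -leqn0 -(HF_pure_eq0 k sm).
have le1 := mult_artinian_le HF0; have le2 := sum_HF_pure k d.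
apply: (@le_trans _ _ (\sum_(m < (sigma d).+1) HF (rcons fs G) m)%N%:Z).
  by rewrite lez_nat.
suff : (\sum_(m < (sigma d).+1) HF (rcons fs G) m)%N%:Z <=
   (\sum_(m < (sigma d).+1) HF (pure_powers k d) m)%N%:Z
   - \sum_(D.+1 <= m < (sigma d).+1) phi k d m - 1.
  by move/le_trans; apply; rewrite !lerD2r lez_nat.
(* Degrees below [D] are compared by [HFle], degree [D] by [HFD], and the higher ones by [part1]. *)
have sumE (F : nat -> nat) : (\sum_(m < (sigma d).+1) F m)%N%:Z =
    \sum_(0 <= m < D) (F m)%:Z + (F D)%:Z + \sum_(D.+1 <= m < (sigma d).+1) (F m)%:Z.
  rewrite (big_morph Posz PoszD erefl) -(big_mkord xpredT (fun m => (F m)%:Z)).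
  by rewrite (big_cat_nat (n := D.+1)) //= big_nat_recr.
rewrite !sumE.
have low : \sum_(0 <= m < D) (HF (rcons fs G) m)%:Z <=
    \sum_(0 <= m < D) (HF (pure_powers k d) m)%:Z.
  by apply: ler_sum => m _; rewrite lez_nat.
have high : \sum_(D.+1 <= m < (sigma d).+1) (HF (rcons fs G) m)%:Z <=
    \sum_(D.+1 <= m < (sigma d).+1) (HF (pure_powers k d) m)%:Z
    - \sum_(D.+1 <= m < (sigma d).+1) phi k d m.
  by rewrite -sumrB; apply: ler_sum_nat => m; rewrite ltnS => /part1.
by move: low high HFD; lia.
Qed.
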